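(* Let $K$ be a non-Archimedean local field with residue field of cardinality $q$, let $0<\alpha<1$, $1\le p<\frac1\alpha$, $\varphi\in L^p(K)$, and $u=D^{-\alpha}\varphi$. Let $\varepsilon=q^{-\nu}$ with $\nu\in\mathbb N$, and let $\sigma\in K$ satisfy $|\sigma|_K=\varepsilon$. Then the truncated operator $D^\alpha_\varepsilon u$ admits the representation $$ \left(D^\alpha_\varepsilon u\right)(x)=c_\alpha d_\alpha\int_K R(\tau)\,\varphi(x-\sigma\tau)\,d\tau $$ for almost every $x\in K$, where $$ R(\tau)=\begin{cases}1-\left(1-\frac1q\right)\dfrac{1}{1-q^{-\alpha}}\,|\tau|_K^{\alpha-1}, & \text{if } 0<|\tau|_K<1,\\ 0, & \text{if } |\tau|_K\ge 1.\end{cases} $$ Moreover, the kernel $R_1(\tau)=c_\alpha d_\alpha R(\tau)$ satisfies $$ R_1(\tau)>0 \ \text{ for } 0<|\tau|_K<1,\qquad \int_K R_1(\tau)\,d\tau=1. $$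
   Context: $K$ is a non-Archimedean local field (a non-discrete totally disconnected locally compact topological field) with normalized absolute value $|\cdot|_K$: if $O=\{x\in K:|x|_K\le 1\}$, $P=\{x\in K:|x|_K<1\}=\beta O$, and $q$ is the cardinality of the finite residue field $O/P$, then $|\beta|_K=q^{-1}$. $dx$ is the Haar measure on the additive group of $K$ normalized so that $O$ has measure $1$; functions are complex-valued and $L^p(K)$ is taken with respect to $dx$. For $0<\alpha<1$ the Riesz potential is $$(D^{-\alpha}\varphi)(x)=d_\alpha\int_K|x-y|_K^{\alpha-1}\varphi(y)\,dy,\qquad d_\alpha=\frac{1-q^{-\alpha}}{1-q^{\alpha-1}};$$ for $\varphi\in L^p(K)$, $1\le p<1/\alpha$, it exists for almost every $x$. The truncated fractional differentiation operator is $$(D^\alpha_\varepsilon u)(x)=c_\alpha\int_{|y-x|_K\ge\varepsilon}\frac{u(y)-u(x)}{|y-x|_K^{\alpha+1}}\,dy,\qquad c_\alpha=\frac{1-q^\alpha}{1-q^{-\alpha-1}}.$$ *)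

(* Defs.v *)
From HB Require Import structures.
From mathcomp Require Import all_boot all_order all_algebra.
From mathcomp Require Import all_classical all_reals all_analysis.
From mathcomp Require Import complex.

Set Implicit Arguments.
Unset Strict Implicit.
Unset Printing Implicit Defensive.
Import Order.TTheory GRing.Theory Num.Theory.
Import numFieldNormedType.Exports.

Local Open Scope classical_set_scope.
Local Open Scope ring_scope.

HB.mixin Record TopologicalZmodule_isTopologicalField K
    & Topological K & GRing.Field K := {
  mul_continuous : continuous (fun x : K * K => x.1 * x.2) ;
  inv_continuous : forall x : K, x != 0 -> {for x, continuous (@GRing.inv K)}
}.

#[short(type="topologicalFieldType")]
HB.structure Definition TopologicalField :=
  {K of TopologicalZmodule K & GRing.Field K
        & TopologicalZmodule_isTopologicalField K}.

(* The measurable types of the library are pointed. *)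
HB.instance Definition _ (K : topologicalFieldType) :=
  isPointed.Build (TopologicalField.sort K) 0.

Record local_field (K : topologicalFieldType) : Prop := {
  local_field_nondiscrete : ~ (forall A : set K, open A) ;
  local_field_totally_disconnected : totally_disconnected [set: K] ;
  local_field_locally_compact : locally_compact [set: K]
}.

Section AbsoluteValue.
Context {K : topologicalFieldType} {R : realType}.
Variable v : K -> R.

Definition integers : set K := [set x | v x <= 1].

Definition max_ideal : set K := [set x | v x < 1].

(* The quotient O / P, as the set of the cosets x + P with x in O. *)
Definition residue_field : set (set K) :=
  [set [set x + y | y in max_ideal] | x in integers].

Record normalized_abs (q : nat) : Prop := {
  abs_ge0 : forall x, 0 <= v x ;
  abs_eq0 : forall x, v x = 0 <-> x = 0 ;
  absM : forall x y, v (x * y) = v x * v y ;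
  abs_ultrametric : forall x y, v (x + y) <= Num.max (v x) (v y) ;
  abs_nbhs : forall (x : K) (A : set K),
    nbhs x A <-> exists2 r : R, 0 < r & [set y | v (y - x) < r] `<=` A ;
  abs_residue : (residue_field #= `I_q)%card ;
  abs_uniformizer : exists beta : K,
    max_ideal = [set beta * x | x in integers] /\ v beta = q%:R^-1
}.

End AbsoluteValue.

Notation borel K := (g_sigma_algebraType (@open K)).

Record haar_measure (K : topologicalFieldType) (R : realType)
    (mu : {measure set (borel K) -> \bar R}) : Prop := {
  haar_neq0 : mu setT <> 0%E ;
  haar_translation : forall (a : K) (A : set (borel K)),
    measurable A -> mu [set (a + x : K) | x in (A : set K)] = mu A ;
  haar_compact : forall A : set K, compact A -> (mu A < +oo)%E ;
  haar_outer_regular : forall A : set (borel K), measurable A ->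
    mu A = ereal_inf [set mu U | U in [set U : set K | open U /\ A `<=` U]] ;
  haar_inner_regular : forall U : set K, open U ->
    mu U = ereal_sup [set mu A | A in [set A : set K | compact A /\ A `<=` U]]
}.

Section ComplexIntegral.
Context {d : measure_display} {T : measurableType d} {R : realType}.
Variable mu : {measure set T -> \bar R}.

Definition Cintegrable (D : set T) (f : T -> R[i]) : Prop :=
  mu.-integrable D (fun x => (complex.Re (f x))%:E) /\
  mu.-integrable D (fun x => (complex.Im (f x))%:E).

(* Meaningful only when [Cintegrable D f]. *)
Definition Cintegral (D : set T) (f : T -> R[i]) : R[i] :=
  Complex (\int[mu]_(x in D) complex.Re (f x)) (\int[mu]_(x in D) complex.Im (f x)).

Definition CLp (p : R) (f : T -> R[i]) : Prop :=
  [/\ measurable_fun setT (fun x => complex.Re (f x)),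
      measurable_fun setT (fun x => complex.Im (f x)) &
      (Lnorm mu p%:E (fun x => (ComplexField.Normc.normc (f x))%:E) < +oo)%E].

End ComplexIntegral.

Section FractionalDerivative.
Context {K : topologicalFieldType} {R : realType}.
Variables (mu : {measure set (borel K) -> \bar R}) (v : K -> R) (q : nat).
Variable alpha : R.

Definition riesz_coef : R := (1 - q%:R `^ (- alpha)) / (1 - q%:R `^ (alpha - 1)).

Definition deriv_coef : R := (1 - q%:R `^ alpha) / (1 - q%:R `^ (- alpha - 1)).

(* The value is arbitrary at the points x where the integral diverges; the
   value 0 of the kernel at y = x is immaterial as well. *)
Definition riesz (phi : K -> R[i]) (x : K) : R[i] :=
  riesz_coef%:C%C * Cintegral mu setT (fun y : K => (v (x - y) `^ (alpha - 1))%:C%C * phi y).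

Definition trunc_domain (eps : R) (x : K) : set K :=
  [set y | eps <= v (y - x)].

Definition trunc_integrand (u : K -> R[i]) (x y : K) : R[i] :=
  (u y - u x) / (v (y - x) `^ (alpha + 1))%:C%C.

Definition trunc_derivative (eps : R) (u : K -> R[i]) (x : K) : R[i] :=
  deriv_coef%:C%C * Cintegral mu (trunc_domain eps x) (trunc_integrand u x).

(* The formula leaves tau = 0 undefined; the value there is set to 0. *)
Definition kernelR (tau : K) : R :=
  if 0 < v tau < 1
  then 1 - (1 - q%:R^-1) * (1 - q%:R `^ (- alpha))^-1 * v tau `^ (alpha - 1)
  else 0.

Definition kernelR1 (tau : K) : R := deriv_coef * riesz_coef * kernelR tau.

End FractionalDerivative.

(* Main.v *)
Require Import Defs.
From HB Require Import structures.
From mathcomp Require Import all_boot all_order all_algebra.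
From mathcomp Require Import all_classical all_reals all_analysis.
From mathcomp Require Import complex measurable_realfun.
From mathcomp Require Import ring lra.

Set Implicit Arguments.
Unset Strict Implicit.
Unset Printing Implicit Defensive.
Import Order.TTheory GRing.Theory Num.Theory.
Import numFieldNormedType.Exports.

Local Open Scope classical_set_scope.
Local Open Scope ring_scope.

(** Write [|t|] for [v t], [eps = |sigma| = q ^ n], [c] and [d] for the
    coefficients of the two operators, [k t = |t| ^ (alpha - 1)] for the Riesz
    kernel and [S] for the integral of [|t| ^ (- alpha - 1)] over
    [|t| >= eps].  If integrals may be exchanged, the truncated derivative of
    [u = d k * phi] at [x] is [c d] times the integral over [z] of
    [(A (x - z) - S k (x - z)) phi z], where [A w] is the integral of
    [|t| ^ (- alpha - 1) k (t + w)] over [|t| >= eps].  The ultrametric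
    inequality makes [A] explicit.
    - If [|w| < eps], then [|t + w| = |t|] on the whole domain, and [A w] is the
      integral of [|t| ^ (-2)], that is [eps ^ (-1)] ([composed_kernel_inside]).
    - If [|w| >= eps], then [A w = S k w] exactly ([composed_kernel_outside]):
      on [|t| < |w|] the factor [k (t + w)] is the constant [k w], and on
      [|t| >= |w|] the equality is an identity between geometric series
      ([composed_kernel_boundary]).
    So [A - S k] vanishes outside the ball of radius [eps] and is, inside, the
    rescaled kernel [eps ^ (-1) R (w / sigma)] ([kernel_composition]); the
    substitution [z = x - sigma tau] gives the representation.

    All these kernels are bounded by multiples of [k], so everything converges
    absolutely, and Fubini's theorem applies, at each point [x] where the integral
    of [k (x - z) |phi z|] is finite.  Almost every point is such a point
    ([riesz_integrable_ae]): near [x], [|phi| <= 1 + |phi| ^ p] and [k] is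
    integrable, so Tonelli's theorem applies; far from [x], comparing [|phi|] with
    [|w| ^ (- 1 / p)] bounds [k |phi|] by an integrable function of [w] plus
    [|phi| ^ p], and it is here that [p < 1 / alpha] is used.

    The measure theory rests on one fact.  The values of [|.|] are the integer
    powers of [q], and a closed ball of radius [q ^ (m + 1)] is the disjoint union
    of [q] translates of the ball of radius [q ^ m]; so a ball of radius [q ^ m]
    has measure [q ^ m] ([haar_ball_measure]).  Balls form a pi-system, and [K] is
    separable, so that balls generate the Borel sets ([borel_balls]).  A measure
    is therefore determined by its values on balls ([borel_measure_unique]), which
    yields the affine changes of variables, and spheres have known measures, which
    turns the integral of a power of [|t|] into a geometric series
    ([integral_spheres]).

    The positivity and the total mass of the kernel are computations with
    [a = q ^ (- alpha)], which satisfies [1 / q < a < 1]. *)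

(** * Arithmetic of the absolute value *)

Section AbsoluteValue.
Context {R : realType} {K : topologicalFieldType} {q : nat} {v : K -> R}.
Hypothesis hv : normalized_abs v q.

Lemma abs0 : v 0 = 0.
Proof. exact/(abs_eq0 hv). Qed.

Lemma abs_neq0 (x : K) : (v x == 0) = (x == 0).
Proof. by apply/eqP/eqP => /(abs_eq0 hv). Qed.

Lemma abs_gt0 (x : K) : (0 < v x) = (x != 0).
Proof. by rewrite lt_neqAle (abs_ge0 hv) andbT eq_sym abs_neq0. Qed.

Lemma abs1 : v 1 = 1.
Proof.
have n0 : v 1 != 0 by rewrite abs_neq0 oner_neq0.
by apply: (mulfI n0); rewrite -(absM hv) !mulr1.
Qed.

Lemma absN x : v (- x) = v x.
Proof.
suff h : v (- 1) = 1 by rewrite -mulN1r (absM hv) h mul1r.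
have : v (- 1) ^+ 2 = 1 by rewrite expr2 -(absM hv) mulrNN mulr1 abs1.
move/eqP; rewrite sqrf_eq1 => /orP[/eqP //|/eqP h].
by have := abs_ge0 hv (- 1); rewrite h ler0N1.
Qed.

Lemma abs_distC x y : v (x - y) = v (y - x).
Proof. by rewrite -absN opprB. Qed.

Lemma absV x : v x^-1 = (v x)^-1.
Proof.
have [->|x0] := eqVneq x 0; first by rewrite invr0 abs0 invr0.
have vx0 : v x != 0 by rewrite abs_neq0.
by apply: (mulfI vx0); rewrite -(absM hv) !mulfV// abs1.
Qed.

Lemma abs_exprz (x : K) (m : int) : v (x ^ m) = v x ^ m.
Proof.
have h n : v (x ^+ n) = v x ^+ n.
  by elim: n => [|n ih]; rewrite ?expr0 ?abs1// !exprS (absM hv) ih.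
by case: m => n; rewrite /exprz ?absV h.
Qed.

Lemma absD_le x y r : v x <= r -> v y <= r -> v (x + y) <= r.
Proof. by move=> xr yr; apply: le_trans (abs_ultrametric hv x y) _; rewrite ge_max xr. Qed.

Lemma absD_lt x y r : v x < r -> v y < r -> v (x + y) < r.
Proof. by move=> xr yr; apply: le_lt_trans (abs_ultrametric hv x y) _; rewrite gt_max xr. Qed.

(** Otherwise both [x + y] and [- x] would be strictly smaller than [y], hence so
    would be their sum, which is [y]. *)
Lemma absD_dominant x y : v x < v y -> v (x + y) = v y.
Proof.
move=> xy; apply/le_anti; rewrite absD_le ?(ltW xy)//= leNgt; apply/negP => h.
have := absD_lt h (_ : v (- x) < v y).
by rewrite absN addrAC subrr add0r ltxx => /(_ xy).
Qed.

(** Representatives turn the cardinality of the residue field, a statement about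
    a set of cosets, into a partition of the unit ball into [q] open unit balls,
    which can be rescaled and measured. *)
Lemma residue_representatives : exists c : nat -> K,
  [/\ forall i, (i < q)%N -> v (c i) <= 1,
      forall i j, (i < q)%N -> (j < q)%N -> v (c i - c j) < 1 -> i = j &
      forall x, v x <= 1 -> exists2 i, (i < q)%N & v (x - c i) < 1].
Proof.
have /card_set_bijP[f [fun_f inj_f surj_f]] : (`I_q #= residue_field v)%card.
  by rewrite card_eq_sym; exact: (abs_residue hv).
have cls i : exists y : K, (i < q)%N ->
    v y <= 1 /\ f i = [set y + z | z in max_ideal v].
  have [iq|iq] := boolP (i < q)%N; last by exists 0.
  by have [y yO <-] := fun_f i iq; exists y.
have [c hc] := choice cls; exists c; split.
- by move=> i /hc[].
- move=> i j iq jq cij; apply: inj_f; rewrite ?inE//.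
  have [[_ ->] [_ ->]] := (hc _ iq, hc _ jq).
  apply/seteqP; split=> _ [z zP <-].
  + by exists (c i - c j + z); [exact: absD_lt|rewrite addrA subrKC].
  + exists (c j - c i + z); last by rewrite addrA subrKC.
    by apply: absD_lt => //; rewrite abs_distC.
- move=> x xO; have : residue_field v [set x + z | z in max_ideal v] by exists x.
  move=> /surj_f[i /= iq fi]; exists i => //.
  have [_ ci] := hc _ iq.
  have : f i x by rewrite fi; exists 0; rewrite ?addr0// /max_ideal/= abs0.
  by rewrite ci => -[y /= yP <-]; rewrite addrAC subrr add0r.
Qed.

(** With a single residue class, [0] and [1] would be close to the same
    representative, hence to each other. *)
Lemma residue_card_gt1 : (1 < q)%N.
Proof.
have [c [cO cinj csurj]] := residue_representatives.
have [i iq vi] : exists2 i, (i < q)%N & v (0 - c i) < 1.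
  by apply: csurj; rewrite abs0.
have [j jq vj] : exists2 j, (j < q)%N & v (1 - c j) < 1.
  by apply: csurj; rewrite abs1.
case: q iq jq => [|[|n]] //; rewrite !ltnS !leqn0 => /eqP i0 /eqP j0.
suff : v 1 < 1 by rewrite abs1 ltxx.
have -> : (1 : K) = (1 - c j) + - (0 - c j) by ring.
by apply: absD_lt => //; rewrite absN j0 -i0.
Qed.

Lemma q_gt1 : 1 < q%:R :> R.
Proof. by rewrite ltr1n residue_card_gt1. Qed.

Lemma q_gt0 : 0 < q%:R :> R.
Proof. exact: lt_trans ltr01 q_gt1. Qed.

Lemma q_neq0 : q%:R != 0 :> R.
Proof. by rewrite gt_eqF// q_gt0. Qed.

Lemma q_expz_gt0 (m : int) : 0 < q%:R ^ m :> R.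
Proof. exact: exprz_gt0 q_gt0. Qed.

Lemma q_expn_gt0 n : 0 < q%:R ^+ n :> R.
Proof. by rewrite exprn_gt0// q_gt0. Qed.

Lemma uniformizer_abs : exists2 beta : K, beta != 0 & v beta = q%:R^-1.
Proof.
have [b [_ vb]] := abs_uniformizer hv; exists b => //.
by rewrite -abs_neq0 vb invr_eq0 q_neq0.
Qed.

(** The values of [v] leave a gap between [q^-1] and [1], because the maximal
    ideal is generated by one element of absolute value [q^-1]. *)
Lemma max_idealE x : (v x < 1) = (v x <= q%:R^-1).
Proof.
have [b [e vb]] := abs_uniformizer hv.
apply/idP/idP => [x1|].
  have : max_ideal v x by [].
  rewrite e => -[y /= yO <-]; rewrite (absM hv) vb.
  by rewrite ler_piMr// invr_ge0 ler0n.
by move=> h; apply: le_lt_trans h _; rewrite invf_lt1 ?q_gt1 ?q_gt0.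
Qed.

(** Multiplying [x] by a power of the uniformizer brings its absolute value into
    the interval from [1] (included) to [q] (excluded).  If the result were not
    [1], its inverse would lie in the gap of [max_idealE]. *)
Lemma abs_value (x : K) : x != 0 -> exists m : int, v x = q%:R ^ m.
Proof.
move=> x0; have vx0 : 0 < v x by rewrite abs_gt0.
have [b b0 vb] := uniformizer_abs.
have L0 : 0 < ln q%:R :> R by rewrite ln_gt0// q_gt1.
pose m := Num.floor (ln (v x) / ln q%:R); exists m.
have vbm : v (b ^ m) = (q%:R ^ m)^-1.
  by rewrite abs_exprz vb -expfV.
(* The logarithm of [v x] is located between consecutive multiples of [ln q]. *)
have lnQ : ln (q%:R ^ m) = m%:~R * ln q%:R :> R.
  by rewrite -powR_intmul ?ler0n// ln_powR.
have bx0 : 0 < v (b ^ m * x) by rewrite (absM hv) vbm mulr_gt0// invr_gt0 q_expz_gt0.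
have lnbx : ln (v (b ^ m * x)) = ln (v x) - m%:~R * ln q%:R.
  by rewrite (absM hv) vbm lnM ?posrE ?invr_gt0 ?q_expz_gt0// lnV ?posrE ?q_expz_gt0// lnQ addrC.
have /andP[h1 h2] := floor_itv (ln (v x) / ln q%:R).
rewrite -/m ler_pdivlMr// in h1; rewrite -/m ltr_pdivrMr// in h2.
rewrite intrD mulrDl mul1r in h2.
have : v (b ^ m * x) = 1.
  apply/eqP; rewrite -ln_eq0// lnbx; apply/negPn/negP => n0.
  have : 0 < ln (v (b ^ m * x)) by rewrite lnbx lt_neqAle eq_sym n0 subr_ge0.
  rewrite -ltr_expR lnK// expR0 => g1.
  have : v (b ^ m * x)^-1 < 1 by rewrite absV invf_lt1.
  (* The inverse lies in the gap, contradicting the choice of [m] as a floor. *)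
  rewrite max_idealE absV lef_pV2 ?posrE ?q_gt0// -ler_ln ?posrE ?q_gt0// lnbx.
  by rewrite leNgt ltrBlDl h2.
rewrite (absM hv) vbm => /(congr1 (fun z => q%:R ^ m * z)).
by rewrite mulrA mulfV ?mul1r ?mulr1// gt_eqF// q_expz_gt0.
Qed.

Lemma abs_surj (m : int) : exists2 x : K, x != 0 & v x = q%:R ^ m.
Proof.
have [b b0 vb] := uniformizer_abs.
exists (b ^ (- m)); first exact: expfz_neq0.
by rewrite abs_exprz vb exprz_inv opprK.
Qed.

End AbsoluteValue.


(** * Balls and the Borel sigma-algebra *)

Definition cball {R : realType} {K : topologicalFieldType} (v : K -> R) (c : K)
  (r : R) : set K := [set y | v (y - c) <= r].

Section Balls.
Context {R : realType} {K : topologicalFieldType} {q : nat} {v : K -> R}.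
Hypothesis hv : normalized_abs v q.
Local Notation B := (borel K).

Lemma cball_center c r : 0 <= r -> cball v c r c.
Proof. by rewrite /cball/= subrr (abs0 hv). Qed.

Lemma cball_recenter c d r : cball v c r d -> cball v c r = cball v d r.
Proof.
move=> cd; apply/seteqP; split=> y h; rewrite /cball/=.
  have -> : y - d = (y - c) + (c - d) by ring.
  by apply: (absD_le hv) => //; rewrite (abs_distC hv).
have -> : y - c = (y - d) + (d - c) by ring.
exact: (absD_le hv).
Qed.

(** Every point of an ultrametric ball is a center of it, so two balls that meet
    are nested.  This makes the balls a pi-system. *)
Lemma cball_setI c d r s : r <= s ->
  cball v c r `&` cball v d s = cball v c r \/
  cball v c r `&` cball v d s = set0.
Proof.
move=> rs; have [[y [cy dy]]|n] := pselect (exists y, (cball v c r `&` cball v d s) y).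
  left; apply/setIidl => z cz.
  rewrite (cball_recenter dy); rewrite (cball_recenter cy) in cz.
  exact: le_trans cz rs.
by right; apply/seteqP; split => // y cy; apply: n; exists y.
Qed.

Lemma open_absP (U : set K) : open U <->
  forall x, U x -> exists2 r, 0 < r & [set y | v (y - x) < r] `<=` U.
Proof.
by rewrite openE; split=> h x /h /(abs_nbhs hv).
Qed.

Lemma open_cball c r : 0 < r -> open (cball v c r).
Proof.
move=> r0; apply/open_absP => x cx; exists r => // y yx.
by rewrite (cball_recenter cx); exact: ltW.
Qed.

Lemma open_abs_lt r : open [set x | v x < r].
Proof.
apply/open_absP => x /= xr; exists r; first exact: le_lt_trans (abs_ge0 hv x) xr.
by move=> y yx /=; rewrite -(subrK x y); exact: (absD_lt hv).
Qed.

Lemma measurable_cball c r : 0 < r -> measurable (cball v c r : set B).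
Proof. by move=> r0; apply: sub_sigma_algebra; exact: open_cball. Qed.

Lemma measurable_abs : measurable_fun setT (v : B -> R).
Proof.
apply: (measurability _ (RGenInftyO.measurableE R)) => _ [_ [r ->] <-].
rewrite setTI; apply: sub_sigma_algebra.
rewrite (_ : _ @^-1` _ = [set x | v x < r]); first exact: open_abs_lt.
by apply/seteqP; split => x; rewrite /= in_itv.
Qed.

(** The elements of the net are the truncations at order [k] of expansions in
    powers of the uniformizer whose digits are representatives of the residue
    field. *)
Lemma unit_ball_net (k : nat) : exists s : seq K, forall x, v x <= 1 ->
  exists2 c, c \in s & v (x - c) <= q%:R ^- k.
Proof.
have [c [_ _ csurj]] := residue_representatives hv.
have [b b0 vb] := uniformizer_abs hv.
elim: k => [|k [s hs]].
  by exists [:: 0] => x xO; exists 0; rewrite ?inE// subr0 expr0 invr1.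
exists [seq d + b ^+ k * c i | d <- s, i <- iota 0 q] => x /hs[d ds dx].
have bk0 : b ^+ k != 0 by rewrite expf_neq0.
have vbk : v (b ^+ k) = q%:R ^- k.
  by rewrite -[b ^+ k]/(b ^ (k%:Z)) (abs_exprz hv) vb -expfV.
have [i iq] : exists2 i, (i < q)%N & v ((x - d) / b ^+ k - c i) < 1.
  apply: csurj; rewrite (absM hv) (absV hv) vbk invrK.
  by rewrite -ler_pdivlMr ?(q_expn_gt0 hv)// div1r.
rewrite (max_idealE hv) => hi.
exists (d + b ^+ k * c i).
  by apply/allpairsP; exists (d, i); rewrite /= mem_iota.
have -> : x - (d + b ^+ k * c i) = b ^+ k * ((x - d) / b ^+ k - c i) by field.
rewrite (absM hv) vbk exprSr invfM; apply: ler_wpM2l => //.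
Qed.

Lemma q_expn_unbounded (r : R) : exists n : nat, r <= q%:R ^+ n.
Proof.
exists (Num.bound `|r|); apply: le_trans (ler_norm r) _.
apply: le_trans (ltW (archi_boundP (normr_ge0 r))) _.
rewrite -natrX ler_nat; apply: ltnW; apply: ltn_expl; exact: (residue_card_gt1 hv).
Qed.

(** The field is the increasing union of the dilates of the unit ball by negative
    powers of the uniformizer. *)
Lemma dense_sequence : exists e : nat -> K, forall x r, 0 < r ->
  exists j, v (x - e j) <= r.
Proof.
have [s hs] := choice unit_ball_net.
have [b b0 vb] := uniformizer_abs hv.
have vbX n : v (b ^+ n) = q%:R ^- n.
  by rewrite -[b ^+ n]/(b ^ (n%:Z)) (abs_exprz hv) vb -expfV.
have Xgt0 := q_expn_gt0 hv.
exists (fun j => if unpickle j is Some (n, k, i)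
  then nth 0 (s k) i / b ^+ n else 0) => x r r0.
have [n hn] := q_expn_unbounded (v x).
have [k hk] := q_expn_unbounded (q%:R ^+ n / r).
have [|c cs hc] := hs k (x * b ^+ n).
  by rewrite (absM hv) vbX ler_pdivrMr// mul1r.
exists (pickle (n, k, index c (s k))); rewrite pickleK nth_index//.
have -> : x - c / b ^+ n = (x * b ^+ n - c) / b ^+ n.
  by field; rewrite expf_neq0.
rewrite (absM hv) (absV hv) vbX invrK.
rewrite ler_pdivrMr// in hk.
rewrite -ler_pdivlMr//; apply: le_trans hc _.
by rewrite ler_pdivlMr// ler_pdivrMl.
Qed.

(** The empty set is added to make the family stable under intersection. *)
Definition balls : set (set B) :=
  [set A | A = set0 \/ exists c (m : int), A = cball v c (q%:R ^ m)].

Lemma balls_measurable : balls `<=` measurable.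
Proof.
move=> _ [->|[c [m ->]]]; first exact: measurable0.
by apply: measurable_cball; exact: (q_expz_gt0 hv).
Qed.

(** An open set is the union of the balls that it contains among those whose
    center is in the dense sequence and whose radius is a power of [q], and these
    are countably many. *)
Lemma borel_balls : @measurable _ B = <<s balls >>.
Proof.
apply/seteqP; split; apply: smallest_sub; first exact: smallest_sigma_algebra.
- move=> U /open_absP Uo.
  have [e he] := dense_sequence.
  pose A j k := if `[< cball v (e j) (q%:R ^- k) `<=` U >]
                then cball v (e j) (q%:R ^- k) else set0.
  have -> : U = \bigcup_j \bigcup_k A j k.
    apply/seteqP; split=> [x Ux|x [j _ [k _]]]; last first.
      by rewrite /A; case: asboolP => // h /h.
    have [r r0 xU] := Uo _ Ux.
    have [k hk] := q_expn_unbounded (2 / r).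
    have kr : q%:R ^- k < r.
      rewrite invf_plt ?posrE ?(q_expn_gt0 hv)//.
      by apply: lt_le_trans hk; rewrite -[X in X < _]mul1r ltr_pM2r ?invr_gt0// ltr1n.
    have k0 : 0 < q%:R ^- k :> R by rewrite invr_gt0 (q_expn_gt0 hv).
    have [j hj] := he x _ k0.
    exists j => //; exists k => //; rewrite /A asboolT// => y ye.
    apply: xU => /=; apply: le_lt_trans kr.
    have -> : y - x = (y - e j) + (e j - x) by ring.
    by apply: (absD_le hv) => //; rewrite (abs_distC hv).
  pose GB := g_sigma_algebraType balls.
  apply: (@bigcupT_measurable _ GB) => j; apply: (@bigcupT_measurable _ GB) => k.
  rewrite /A; case: asboolP => _; last exact: (@measurable0 _ GB).
  by apply: sub_sigma_algebra; right; exists (e j), (- k%:Z); rewrite -exprnN.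
- exact: sigma_algebra_measurable.
- exact: balls_measurable.
Qed.

Lemma balls_setI_closed : setI_closed balls.
Proof.
have h c d (m n : int) : q%:R ^ m <= q%:R ^ n :> R ->
    balls (cball v c (q%:R ^ m) `&` cball v d (q%:R ^ n)).
  move=> mn; have [->|->] := cball_setI c d mn; last by left.
  by right; exists c, m.
move=> _ _ [->|[c [m ->]]] [->|[d [n ->]]]; rewrite ?set0I ?setI0; try by left.
have [/h|/ltW/h] := leP (q%:R ^ m) (q%:R ^ n : R) => //.
by rewrite setIC.
Qed.

Lemma bigcup_cball : \bigcup_n cball v 0 (q%:R ^ n%:Z) = setT.
Proof.
apply/seteqP; split=> // x _; have [n hn] := q_expn_unbounded (v x).
by exists n => //; rewrite /cball /= subr0.
Qed.

Lemma borel_measure_unique (m1 m2 : {measure set B -> \bar R}) :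
  (forall c (m : int), m1 (cball v c (q%:R ^ m)) = m2 (cball v c (q%:R ^ m))) ->
  (forall c (m : int), (m1 (cball v c (q%:R ^ m)) < +oo)%E) ->
  forall A, measurable A -> m1 A = m2 A.
Proof.
move=> m12 m1oo A mA.
apply: (measure_unique balls (fun n => cball v 0 (q%:R ^ n%:Z))) => //.
- exact: borel_balls.
- exact: balls_setI_closed.
- by move=> n; right; exists 0, n%:Z.
- exact: bigcup_cball.
- by move=> _ [->|[c [m ->]]]; rewrite ?measure0.
Qed.

Lemma affine_preimage_cball (a b c : K) r : a != 0 ->
  (fun t => a * t + b) @^-1` cball v c r = cball v ((c - b) / a) (r / v a).
Proof.
move=> a0; apply/seteqP; split=> t; rewrite /cball/=.
  have -> : a * t + b - c = a * (t - (c - b) / a) by field.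
  by rewrite (absM hv) ler_pdivlMr ?(abs_gt0 hv)// mulrC.
have -> : a * t + b - c = a * (t - (c - b) / a) by field.
by rewrite (absM hv) ler_pdivlMr ?(abs_gt0 hv)// mulrC.
Qed.

Lemma measurable_affine (a b : K) : a != 0 ->
  measurable_fun setT (fun t : B => (a * (t : K) + b : B)).
Proof.
move=> a0; apply: (measurability _ borel_balls) => _ [_ [->|[c [m ->]]] <-].
  by rewrite preimage_set0 setI0.
rewrite setTI (affine_preimage_cball _ _ _ a0); apply: measurable_cball.
by rewrite divr_gt0 ?(q_expz_gt0 hv)// (abs_gt0 hv).
Qed.

(** The preimage of a ball is a countable union of products of balls, by
    separability.  Joint measurability of the difference is what makes
    convolutions accessible to Fubini's theorem. *)
Lemma measurable_sub :
  measurable_fun setT (fun z : B * B => ((z.1 : K) - (z.2 : K) : B)).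
Proof.
apply: (measurability _ borel_balls) => _ [_ [->|[c [m ->]]] <-].
  by rewrite preimage_set0 setI0.
have [e he] := dense_sequence.
set r := q%:R ^ m; have r0 : 0 < r by exact: (q_expz_gt0 hv).
rewrite setTI (_ : _ @^-1` _ =
  \bigcup_j (cball v (c + e j) r `*` cball v (e j) r)).
  by apply: bigcupT_measurable => j; apply: measurableX; exact: measurable_cball.
apply/seteqP; split=> [[x y] /= h|[x y] [j _ [/= h1 h2]]]; rewrite /cball/=.
  have [j hj] := he y r r0; exists j => //; split => //=; rewrite /cball/=.
  have -> : x - (c + e j) = (x - y - c) + (y - e j) by ring.
  exact: (absD_le hv).
have -> : x - y - c = (x - (c + e j)) + - (y - e j) by ring.
by apply: (absD_le hv) => //; rewrite (absN hv).
Qed.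

End Balls.


(** * Haar measure of balls and affine changes of variables *)

(** This property determines the measure on Borel sets; it is all that the
    computation of integrals requires of a Haar measure. *)
Definition ball_measure {R : realType} {K : topologicalFieldType} (v : K -> R)
    (q : nat) (mu : set (borel K) -> \bar R) : Prop :=
  forall c (m : int), mu (cball v c (q%:R ^ m)) = (q%:R ^ m)%:E.

Section HaarBalls.
Context {R : realType} {K : topologicalFieldType} {q : nat} {v : K -> R}.
Hypothesis hv : normalized_abs v q.
Context {mu : {measure set (borel K) -> \bar R}}.
Hypotheses (hmu : haar_measure mu) (hmuO : mu (integers v) = 1%E).
Local Notation Q := (q%:R : R).

Let mball c (m : int) := measurable_cball hv c (q_expz_gt0 hv m).

Lemma haar_cball_center c (m : int) : mu (cball v c (Q ^ m)) = mu (cball v 0 (Q ^ m)).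
Proof.
rewrite -(haar_translation hmu c (mball 0 m)); congr (mu _).
apply/seteqP; split=> [x cx|_ [y /= cy <-]]; rewrite /cball/=.
  by exists (x - c); rewrite /= ?subr0// subrKC.
by rewrite /cball/= subr0 in cy; rewrite addrAC subrr add0r.
Qed.

(** Scaled by an element of absolute value [q ^ (m + 1)], the partition of the
    unit ball into residue classes becomes a partition of the larger ball into
    [q] balls of radius [q ^ m]. *)
Lemma haar_cball_step (m : int) :
  mu (cball v 0 (Q ^ (m + 1))) = (mu (cball v 0%R (Q ^ m)%R) *+ q)%E.
Proof.
have [c [cO cinj csurj]] := residue_representatives hv.
have [a a0 va] := abs_surj hv (m + 1).
have Qm : Q ^ (m + 1) = Q ^ m * Q by rewrite expfzDr ?expr1z// (q_neq0 hv).
have Qm0 := q_expz_gt0 hv m.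
have mQ : Q ^ m < Q ^ (m + 1) by rewrite Qm ltr_pMr// (q_gt1 hv).
pose F (i : 'I_q) : set (borel K) := cball v (a * c i) (Q ^ m).
have -> : cball v 0 (Q ^ (m + 1)) = \big[setU/set0]_(i < q) F i.
  rewrite -bigcup_seq; apply/seteqP; split=> [x|x [i _]]; rewrite /F /cball/=.
    rewrite subr0 => xm; have [|i iq] := csurj (x / a).
      by rewrite (absM hv) (absV hv) va ler_pdivrMr ?mul1r// (q_expz_gt0 hv).
    rewrite (max_idealE hv) => hi; exists (Ordinal iq) => /=; first exact: mem_index_enum.
    have -> : x - a * c i = a * (x / a - c i) by field.
    by rewrite (absM hv) va Qm -mulrA ger_pMr// -ler_pdivlMl ?mulr1 ?(q_gt0 hv).
  move=> h; rewrite subr0 -(subrK (a * c i) x); apply: (absD_le hv).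
    exact: le_trans h (ltW mQ).
  by rewrite (absM hv) va ler_piMr ?cO// ltW// (q_expz_gt0 hv).
rewrite measure_bigsetU_ord; last 2 first.
- by move=> i; exact: mball.
- apply/trivIsetP => i j _ _ /eqP ij; apply/seteqP; split=> // x [xi xj].
  apply: ij; apply/val_inj/cinj => //=.
  have : v (a * (c i - c j)) <= Q ^ m.
    have -> : a * (c i - c j) = (x - a * c j) + - (x - a * c i) by ring.
    by apply: (absD_le hv) => //; rewrite (absN hv).
  rewrite (absM hv) va => h; rewrite -(@ltr_pM2l _ (Q ^ (m + 1))) ?(q_expz_gt0 hv)//.
  by rewrite mulr1; exact: le_lt_trans h mQ.
rewrite (eq_bigr (fun=> mu (cball v 0 (Q ^ m)))) => [|i _].
  by rewrite sumr_const card_ord.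
exact: haar_cball_center.
Qed.

Lemma haar_ball_measure : ball_measure v q mu.
Proof.
have Q0 := q_neq0 hv.
(* The value on the unit ball propagates to all radii, upwards and downwards. *)
have up (m : int) : mu (cball v 0 (Q ^ m)) = (Q ^ m)%:E ->
    mu (cball v 0 (Q ^ (m + 1))) = (Q ^ (m + 1))%:E.
  move=> h; rewrite haar_cball_step h -EFin_natmul; congr EFin.
  by rewrite expfzDr// expr1z mulr_natr.
have down (m : int) : mu (cball v 0 (Q ^ (m + 1))) = (Q ^ (m + 1))%:E ->
    mu (cball v 0 (Q ^ m)) = (Q ^ m)%:E.
  have : (0 <= mu (cball v 0%R (Q ^ m)%R))%E by exact: measure_ge0.
  rewrite haar_cball_step; case: (mu (cball v 0 (Q ^ m))) => [r|_|//].
    rewrite -EFin_natmul expfzDr// expr1z => _ [].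
    by rewrite -(mulr_natr r) => rq; rewrite (mulIf Q0 rq).
  (* An infinite measure of the smaller ball would force an infinite measure of the larger one. *)
  by rewrite -mule_natl gt0_muley// lte_fin (q_gt0 hv).
have base : mu (cball v 0 (Q ^ 0)) = (Q ^ 0)%:E.
  rewrite expr0z -hmuO; congr (mu _); apply/seteqP.
  by split=> x; rewrite /cball /integers/= subr0.
move=> c m; rewrite haar_cball_center.
elim/int_rec: m => [//|n ih|n ih].
  by rewrite -addn1 PoszD; exact: up.
by apply: down; rewrite -addn1 PoszD opprD subrK.
Qed.

End HaarBalls.

Section AffineChange.
Context {R : realType} {K : topologicalFieldType} {q : nat} {v : K -> R}.
Hypothesis hv : normalized_abs v q.
Context {mu : {measure set (borel K) -> \bar R}}.
Hypothesis hball : ball_measure v q mu.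
Local Notation Q := (q%:R : R).
Local Notation B := (borel K).

Lemma ball_measure_sigma_finite : sigma_finite setT mu.
Proof.
exists (fun n => cball v 0 (Q ^ n%:Z)); first by rewrite (bigcup_cball hv).
move=> n; split; first exact: (measurable_cball hv _ (q_expz_gt0 hv _)).
by rewrite hball ltry.
Qed.

(** The image of [mu] under the affine map and the multiple of [mu] by
    [(v a)^-1] agree on balls. *)
Lemma ge0_integral_affine (a b : K) (f : B -> \bar R) : a != 0 ->
  measurable_fun setT f -> (forall x, 0 <= f x)%E ->
  (\int[mu]_t f (a * (t : K) + b)%R = ((v a)^-1)%:E * \int[mu]_y f y)%E.
Proof.
move=> a0 mf f0; have mphi := measurable_affine hv b a0.
have va0 : 0 < v a by rewrite (abs_gt0 hv).
have va0' : 0 <= (v a)^-1 by rewrite invr_ge0 ltW.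
transitivity (\int[pushforward mu (fun t : B => (a * (t : K) + b : B)%R)]_y f y)%E.
  by rewrite [RHS](ge0_integral_pushforward mphi)//.
pose k : {nonneg R} := NngNum va0'.
transitivity (\int[mscale k mu]_y f y)%E; last by rewrite ge0_integral_mscale.
apply: eq_measure_integral => A mA _.
have [n van] := abs_value hv a0.
have pre c (m : int) :
    pushforward mu (fun t : B => (a * (t : K) + b : B)) (cball v c (Q ^ m)) =
    (Q ^ (m - n))%:E.
  rewrite /pushforward (affine_preimage_cball hv _ _ _ a0) van.
  by rewrite invr_expz -expfzDr ?(q_neq0 hv)// hball.
apply: (borel_measure_unique hv) mA => [c m|c m] /=; rewrite pre ?ltry//.
rewrite /mscale hball /= van -EFinM; congr EFin.
by rewrite mulrC invr_expz -expfzDr ?(q_neq0 hv).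
Qed.

Lemma integrable_affine (a b : K) (f : B -> \bar R) : a != 0 ->
  mu.-integrable setT f -> mu.-integrable setT (fun t : B => f (a * (t : K) + b)).
Proof.
move=> a0 /integrableP[mf foo]; apply/integrableP; split.
  exact: (measurableT_comp mf (measurable_affine hv b a0)).
rewrite (ge0_integral_affine b (f := abse \o f))//; last 2 first.
- exact: measurableT_comp.
- by move=> x /=; exact: abse_ge0.
by rewrite lte_mul_pinfty// lee_fin invr_ge0 (abs_ge0 hv).
Qed.

Lemma integral_affine (a b : K) (f : B -> \bar R) : a != 0 ->
  mu.-integrable setT f ->
  (\int[mu]_t f (a * (t : K) + b)%R = ((v a)^-1)%:E * \int[mu]_y f y)%E.
Proof.
move=> a0 fi; have mf := measurable_int _ fi.
rewrite integralE [in RHS]integralE.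
rewrite muleBr ?integrable_add_def//.
have mp := measurable_funepos mf. have mn := measurable_funeneg mf.
rewrite -(ge0_integral_affine b (f := f^\+%E))// -(ge0_integral_affine b (f := f^\-%E))//.
by congr (_ - _)%E; apply: eq_integral => t _; rewrite ?funeposE ?funenegE.
Qed.

Lemma borel_set1 (c : K) : measurable ([set c] : set B).
Proof.
rewrite (_ : [set c] = \bigcap_n cball v c (Q ^ (- n%:Z))).
  by apply: bigcapT_measurable => k; exact: (measurable_cball hv _ (q_expz_gt0 hv _)).
apply/seteqP; split=> [_ -> i _|x cx] /=.
  by apply: (cball_center hv); exact: ltW (q_expz_gt0 hv _).
apply/eqP; rewrite -subr_eq0 -(abs_neq0 hv) eq_le (abs_ge0 hv) andbT.
apply/ler_addgt0Pr => r r0; rewrite add0r.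
have [k hk] := q_expn_unbounded hv r^-1.
apply: le_trans (cx k I) _; rewrite -exprnN.
by rewrite invf_ple ?posrE ?(q_expn_gt0 hv).
Qed.

Lemma ball_measure_set1 (c : K) : mu [set c] = 0%E.
Proof.
apply/eqP; rewrite eq_le measure_ge0 andbT; apply/lee_addgt0Pr => e e0; rewrite add0e.
have [n hn] := q_expn_unbounded hv e^-1.
have Qn : Q ^ (- n%:Z) <= e.
  by rewrite -exprnN invf_ple ?posrE ?(q_expn_gt0 hv).
apply: (@le_trans _ _ (mu (cball v c (Q ^ (- n%:Z))))); last by rewrite hball lee_fin.
apply: le_measure; rewrite ?inE.
- exact: borel_set1.
- exact: (measurable_cball hv _ (q_expz_gt0 hv _)).
- by move=> _ ->; apply: (cball_center hv); apply: ltW; exact: (q_expz_gt0 hv).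
Qed.

End AffineChange.


(** * Integrals of functions of the absolute value *)

Section Radial.
Context {R : realType} {K : topologicalFieldType} {q : nat} {v : K -> R}.
Hypothesis hv : normalized_abs v q.
Context {mu : {measure set (borel K) -> \bar R}}.
Hypothesis hball : ball_measure v q mu.
Local Notation Q := (q%:R : R).
Local Notation B := (borel K).

Definition sphere (m : int) : set K := [set t | v t = Q ^ m].

Definition far (m : int) : set K := [set t | Q ^ m <= v t].

Definition oball (m : int) : set K := [set t | v t < Q ^ m].

Lemma abs_lt_expz (x : K) (m : int) : (v x < Q ^ m) = (v x <= Q ^ (m - 1)).
Proof.
have [->|/(abs_value hv)[n ->]] := eqVneq x 0.
  by rewrite (abs0 hv) !ltW ?(q_expz_gt0 hv).
rewrite ltr_eXz2l ?(q_gt1 hv)// ler_eXz2l ?(q_gt1 hv)//.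
by rewrite lerBrDr lezD1.
Qed.

Lemma measurable_far m : measurable (far m : set B).
Proof.
rewrite (_ : far m = v @^-1` `[Q ^ m, +oo[%classic).
  by rewrite -[X in measurable X]setTI; exact: (measurable_abs hv).
by apply/seteqP; split => x; rewrite /far/= in_itv/= andbT.
Qed.

Lemma measurable_oball m : measurable (oball m : set B).
Proof.
by apply: sub_sigma_algebra; exact: (open_abs_lt hv).
Qed.

Lemma sphereE m : sphere m = cball v 0 (Q ^ m) `\` cball v 0 (Q ^ (m - 1)).
Proof.
apply/seteqP; split=> x; rewrite /sphere /cball/= subr0.
  by move=> xm; rewrite xm lexx; split=> //; rewrite -xm -abs_lt_expz xm ltxx.
by move=> [xm]; rewrite -abs_lt_expz => /negP; rewrite -leNgt => mx; apply/le_anti/andP.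
Qed.

Lemma measurable_sphere m : measurable (sphere m : set B).
Proof.
rewrite sphereE; apply: measurableD; exact: (measurable_cball hv _ (q_expz_gt0 hv _)).
Qed.

Lemma sphere_measure m : mu (sphere m) = ((1 - Q^-1) * Q ^ m)%:E.
Proof.
rewrite sphereE measureD; last 3 first.
- exact: (measurable_cball hv _ (q_expz_gt0 hv _)).
- exact: (measurable_cball hv _ (q_expz_gt0 hv _)).
- by apply: le_lt_trans (ltry (Q ^ m)); rewrite -(hball 0 m).
rewrite setIidr; last first.
  by move=> x /= h; rewrite /cball/=; apply: ltW; rewrite abs_lt_expz.
transitivity ((Q ^ m)%:E - (Q ^ (m - 1))%:E)%E.
  by congr (_ - _)%E; exact: hball.
rewrite -EFinB; congr EFin.
by rewrite expfzDr ?(q_neq0 hv)// exprN1 mulrBl mul1r [Q^-1 * _]mulrC.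
Qed.

(** On a sphere the integrand is constant, and the hypothesis says that its value
    times the radius is geometric in the index; the factor [1 - q^-1] comes from
    the measure of a sphere. *)
Lemma integral_spheres (g : R -> R) (i : nat -> int) (a r : R) :
  injective i -> measurable_fun setT g -> (forall y, 0 <= g y) ->
  0 <= r < 1 -> (forall k, g (Q ^ i k) * Q ^ i k = a * r ^+ k) ->
  (\int[mu]_(t in \bigcup_k sphere (i k)) (g (v t))%:E =
   ((1 - Q^-1) * a / (1 - r))%:E)%E.
Proof.
move=> inji mg g0 /andP[r0 r1] gi.
rewrite ge0_integral_bigcup; first last.
- apply/trivIsetP => j k _ _ jk; apply/seteqP; split=> // x [].
  rewrite /sphere/= => -> h; move/eqP: jk; apply; apply: inji.
  by apply: (ieexprIz (q_gt0 hv)) h; rewrite gt_eqF// (q_gt1 hv).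
- by move=> x _; rewrite lee_fin.
- apply/measurable_EFinP; apply: measurable_funTS.
  exact: (measurableT_comp mg (measurable_abs hv)).
- by move=> k; exact: measurable_sphere.
have term k : (\int[mu]_(t in sphere (i k)) (g (v t))%:E =
    ((1 - Q^-1) * a * r ^+ k)%:E)%E.
  rewrite (eq_integral (cst (g (Q ^ i k))%:E)); last first.
    by move=> x; rewrite inE /sphere/= => ->.
  rewrite integral_cst ?sphere_measure -?EFinM; last exact: measurable_sphere.
  by congr EFin; rewrite mulrCA gi mulrA.
apply/cvg_lim => //.
under eq_fun do under eq_bigr do rewrite term.
under eq_fun do rewrite sumEFin.
apply: cvg_EFin; first by apply: nearW.
by apply: (cvg_geometric_series (a := (1 - Q^-1) * a)); rewrite ger0_norm.
Qed.

Lemma powR_expz (m : int) (e : R) : (Q ^ m) `^ e = Q `^ (m%:~R * e).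
Proof. by rewrite -powR_intmul ?ler0n// -powRrM. Qed.

Lemma q_powRD (x y : R) : Q `^ (x + y) = Q `^ x * Q `^ y.
Proof. by rewrite powRD// (q_neq0 hv) implybT. Qed.

Lemma q_powR_gt0 (x : R) : 0 < Q `^ x.
Proof. exact: powR_gt0 (q_gt0 hv). Qed.

Lemma q_powR_lt1 (s : R) : 0 < s -> Q `^ (- s) < 1.
Proof.
move=> s0; rewrite powRN invf_lt1 ?q_powR_gt0//.
by rewrite /powR (negbTE (q_neq0 hv)) -[X in X < _]expR0 ltr_expR mulr_gt0// ln_gt0// (q_gt1 hv).
Qed.

Lemma powR_mulexpz (m : int) (e : R) : (Q ^ m) `^ (e - 1) * Q ^ m = Q `^ (m%:~R * e).
Proof.
by rewrite powR_expz -[X in _ * X]powR_intmul ?ler0n// -q_powRD; congr (_ `^ _); ring.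
Qed.

Lemma integral_far (m : int) (s : R) : 0 < s ->
  (\int[mu]_(t in far m) (v t `^ (- s - 1))%:E =
   ((1 - Q^-1) * Q `^ (- (m%:~R * s)) / (1 - Q `^ (- s)))%:E)%E.
Proof.
move=> s0.
have -> : far m = \bigcup_k sphere (m + k%:Z).
  apply/seteqP; split=> [t mt|t [k _]]; last first.
    by rewrite /sphere /far/= => ->; rewrite ler_eXz2l ?(q_gt1 hv)// lerDl.
  have /(abs_value hv)[n vt] : t != 0.
    by rewrite -(abs_gt0 hv); exact: lt_le_trans (q_expz_gt0 hv m) mt.
  move: mt; rewrite /far /= vt ler_eXz2l ?(q_gt1 hv)// => mn.
  by exists (absz (n - m)%R) => //; rewrite /sphere/= gez0_abs ?subr_ge0// subrKC.
apply: (integral_spheres (g := fun y => y `^ (- s - 1))).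
- by move=> j k /addrI[].
- exact: measurable_powR.
- by move=> y; exact: powR_ge0.
- by rewrite powR_ge0 q_powR_lt1.
move=> k; rewrite powR_mulexpz -powR_mulrn ?powR_ge0// -powRrM -q_powRD.
by congr (_ `^ _); rewrite intrD; ring.
Qed.

(** The point [0] is in the domain but on no sphere.  It does not contribute,
    since [0 `^ e = 0] for [e != 0]; this is the reason for [s != 1]. *)
Lemma integral_oball (m : int) (s : R) : 0 < s -> s != 1 ->
  (\int[mu]_(t in oball m) (v t `^ (s - 1))%:E =
   ((1 - Q^-1) * Q `^ ((m - 1)%:~R * s) / (1 - Q `^ (- s)))%:E)%E.
Proof.
move=> s0 s1.
have s10 : s - 1 != 0 by rewrite subr_eq0.
rewrite -(integral_spheres (g := fun y => y `^ (s - 1)) (i := fun k => m - 1 - k%:Z)).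
- rewrite integral_mkcond [RHS]integral_mkcond; apply: eq_integral => t _.
  rewrite /patch; case: ifPn; case: ifPn => //; rewrite ?inE ?notin_setE.
  + move=> tS tm; have [->|/(abs_value hv)[n vt]] := eqVneq t 0.
      by rewrite (abs0 hv) powR0.
    exfalso; apply: tS; exists (absz (m - 1 - n)%R) => //; rewrite /sphere/= vt.
    have nm : n <= m - 1.
      by move: tm; rewrite /oball/= abs_lt_expz vt ler_eXz2l// (q_gt1 hv).
    by rewrite gez0_abs ?subr_ge0// subKr.
  + move=> [k _]; rewrite /sphere /oball/= => vt; case.
    by rewrite abs_lt_expz vt ler_eXz2l ?(q_gt1 hv)// gerBl.
- by move=> j k /addrI/oppr_inj[].
- exact: measurable_powR.
- by move=> y; exact: powR_ge0.
- by rewrite powR_ge0 q_powR_lt1.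
move=> k; rewrite powR_mulexpz -powR_mulrn ?powR_ge0// -powRrM -q_powRD.
by congr (_ `^ _); rewrite !intrD !intrN; ring.
Qed.

End Radial.


(** * The composition of the two kernels *)

Section Kernel.
Context {R : realType} {K : topologicalFieldType} {q : nat} {v : K -> R}.
Hypothesis hv : normalized_abs v q.
Context {mu : {measure set (borel K) -> \bar R}}.
Hypothesis hball : ball_measure v q mu.
Local Notation Q := (q%:R : R).
Local Notation B := (borel K).
Local Notation far := (@far R K q v).
Local Notation oball := (@oball R K q v).
Local Notation sphere := (@sphere R K q v).
Context {alpha : R}.
Hypotheses (alpha0 : 0 < alpha) (alpha1 : alpha < 1).

Lemma measurable_shift (w : K) : measurable_fun setT (fun t : B => ((t : K) + w : B)).
Proof.
rewrite (_ : (fun _ => _) = (fun t : B => (1 * (t : K) + w : B))).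
  by apply: (measurable_affine hv); rewrite oner_neq0.
by apply/funext => t; rewrite mul1r.
Qed.

Lemma measurable_abs_shift_powR (e : R) (w : K) :
  measurable_fun setT (fun t : B => v ((t : K) + w) `^ e).
Proof.
apply: (measurableT_comp (measurable_powR e)).
exact: (measurableT_comp (measurable_abs hv) (measurable_shift w)).
Qed.

Lemma measurable_abs_powR (e : R) : measurable_fun setT (fun t : B => v t `^ e).
Proof. exact: (measurableT_comp (measurable_powR e) (measurable_abs hv)). Qed.

Lemma measurable_composed_kernel (w : K) :
  measurable_fun setT
    (fun t : B => (v t `^ (- alpha - 1) * v ((t : K) + w) `^ (alpha - 1))%:E).
Proof.
apply/measurable_EFinP; apply: measurable_funM.
- exact: measurable_abs_powR.
- exact: measurable_abs_shift_powR.
Qed.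

Lemma far_neq0 (n : int) t : far n t -> t != 0.
Proof. by move=> h; rewrite -(abs_gt0 hv); exact: lt_le_trans (q_expz_gt0 hv n) h. Qed.

Lemma abs_powRD t (e f : R) : t != 0 -> v t `^ e * v t `^ f = v t `^ (e + f).
Proof. by move=> t0; rewrite powRD// (abs_neq0 hv) t0 implybT. Qed.

Lemma integral_far_inv2 (n : int) :
  (\int[mu]_(t in far n) (v t `^ (- 1 - 1))%:E = ((Q ^ n)^-1)%:E)%E.
Proof.
rewrite (integral_far hv hball)//; congr EFin.
rewrite mulr1 powR_inv1 ?ler0n// powRN powR_intmul ?ler0n// mulrAC divff ?mul1r//.
by rewrite subr_eq0 gt_eqF// invf_lt1 ?(q_gt1 hv)// (q_gt0 hv).
Qed.

(** Here [v w < v t] on the whole domain, so that [v (t + w) = v t]. *)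
Lemma composed_kernel_inside (n : int) (w : K) : v w < Q ^ n ->
  (\int[mu]_(t in far n) (v t `^ (- alpha - 1) * v ((t : K) + w) `^ (alpha - 1))%:E =
   ((Q ^ n)^-1)%:E)%E.
Proof.
move=> wn; rewrite -integral_far_inv2; apply: eq_integral => t; rewrite inE => tn.
rewrite [_ + w]addrC (absD_dominant hv) ?(lt_le_trans wn)//.
by rewrite (abs_powRD _ _ (far_neq0 tn)); congr (_ `^ _)%:E; ring.
Qed.

Lemma far_split (m : int) : far m = sphere m `|` far (m + 1).
Proof.
apply/seteqP; split=> t; rewrite /far /sphere/=.
  move=> mt; have [//|tm] := boolP (Q ^ (m + 1) <= v t); first by right.
  left; apply/le_anti; rewrite mt andbT.
  by move: tm; rewrite -ltNge (abs_lt_expz hv) addrK.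
by case=> [->//|]; apply: le_trans; rewrite ler_eXz2l ?(q_gt1 hv)// lerDl.
Qed.

Lemma oball_split (m : int) : oball (m + 1) = sphere m `|` oball m.
Proof.
apply/seteqP; split=> t; rewrite /oball /sphere/= (abs_lt_expz hv t (m + 1)) addrK.
  by rewrite le_eqVlt => /orP[/eqP|]; [left|right].
by case=> [->//|/ltW].
Qed.

Lemma oball_cball (m : int) : oball m = cball v 0 (Q ^ (m - 1)).
Proof. by apply/seteqP; split=> t; rewrite /oball /cball/= subr0 (abs_lt_expz hv). Qed.

(** The ball of radius [v w] is invariant under translation by [w]. *)
Lemma integral_oball_shift (m : int) (w : K) : v w = Q ^ m ->
  (\int[mu]_(t in oball (m + 1)) (v ((t : K) + w)%R `^ (alpha - 1))%:E =
   \int[mu]_(t in oball (m + 1)) (v t `^ (alpha - 1))%:E)%E.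
Proof.
move=> vw; rewrite integral_mkcond [RHS]integral_mkcond.
pose F : B -> \bar R := (fun t : B => (v t `^ (alpha - 1))%:E) \_ (oball (m + 1)).
rewrite -/F.
have mF : measurable_fun setT F.
  apply/(measurable_restrictT _ _).1; first exact: (measurable_oball hv).
  by apply: measurable_funTS; apply/measurable_EFinP; exact: measurable_abs_powR.
have F0 x : (0 <= F x)%E by rewrite /F /patch; case: ifP => // _; rewrite lee_fin powR_ge0.
have := ge0_integral_affine hv hball w (oner_neq0 K) mF F0.
rewrite (abs1 hv) invr1 mul1e => <-; apply: eq_integral => t _.
rewrite mul1r /F /patch.
have wm : v w < Q ^ (m + 1) by rewrite (abs_lt_expz hv) addrK vw.
suff -> : ((t + w)%R \in oball (m + 1)) = (t \in oball (m + 1)) by [].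
apply/idP/idP; rewrite !inE /oball/= => h; last exact: (absD_lt hv).
by rewrite -(addrK w t); apply: (absD_lt hv); rewrite ?(absN hv).
Qed.

(** The sphere through [w] is a ball minus a smaller ball.  On the larger one the
    translation by [w] is harmless, and on the smaller one [v (t + w) = v w]. *)
Lemma integral_sphere_shift (m : int) (w : K) : v w = Q ^ m ->
  (\int[mu]_(t in sphere m) (v ((t : K) + w)%R `^ (alpha - 1))%:E =
   ((1 - Q^-1) * Q `^ (m%:~R * alpha) / (1 - Q `^ (- alpha)) -
    Q `^ (m%:~R * alpha) * Q^-1)%:E)%E.
Proof.
move=> vw.
have := integral_oball_shift vw.
rewrite (integral_oball hv hball _ alpha0); last by rewrite lt_eqF.
rewrite addrK oball_split ge0_integral_setU; first last.
- apply/disj_setPS => t [].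
  by rewrite /sphere /oball/= => ->; rewrite ltxx.
- by move=> t _; rewrite lee_fin powR_ge0.
- by apply/measurable_EFinP; apply: measurable_funTS; exact: measurable_abs_shift_powR.
- exact: (measurable_oball hv).
- exact: (measurable_sphere hv).
have -> : (\int[mu]_(t in oball m) (v ((t : K) + w)%R `^ (alpha - 1))%:E =
    (Q `^ (m%:~R * alpha) * Q^-1)%:E)%E.
  rewrite (eq_integral (cst ((Q ^ m) `^ (alpha - 1))%:E)); last first.
    by move=> t; rewrite inE /oball/= -vw => h; rewrite (absD_dominant hv).
  rewrite integral_cst; last exact: (measurable_oball hv).
  rewrite oball_cball.
  transitivity (((Q ^ m) `^ (alpha - 1))%:E * (Q ^ (m - 1))%:E)%E.
    by congr (_ * _)%E; exact: hball.
  rewrite -EFinM; congr EFin.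
  by rewrite expfzDr ?(q_neq0 hv)// exprN1 mulrA (powR_mulexpz hv).
move=> h; rewrite EFinB -h addeK//.
Qed.

(** The sphere [v t = v w] contributes through [integral_sphere_shift], and its
    complement in the domain through [composed_kernel_inside], for which [w] is
    small. *)
Lemma composed_kernel_boundary (m : int) (w : K) : v w = Q ^ m ->
  (\int[mu]_(t in far m) (v t `^ (- alpha - 1) * v ((t : K) + w)%R `^ (alpha - 1))%:E =
   (v w `^ (alpha - 1))%:E * \int[mu]_(t in far m) (v t `^ (- alpha - 1))%:E)%E.
Proof.
move=> vw; rewrite (integral_far hv hball)// {1}far_split ge0_integral_setU; first last.
- apply/disj_setPS => t [].
  by rewrite /sphere /far/= => ->; rewrite leNgt ltr_eXz2l ?(q_gt1 hv)// ltrDl.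
- by move=> t _; rewrite lee_fin mulr_ge0// powR_ge0.
- by apply: measurable_funTS; exact: measurable_composed_kernel.
- exact: (measurable_far hv).
- exact: (measurable_sphere hv).
rewrite composed_kernel_inside; last by rewrite (abs_lt_expz hv) addrK vw.
rewrite (eq_integral (fun t : B => ((Q ^ m) `^ (- alpha - 1))%:E *
    (v ((t : K) + w)%R `^ (alpha - 1))%:E)%E); last first.
  by move=> t; rewrite inE /sphere/= => ->; rewrite EFinM.
rewrite ge0_integralZl//; first last.
- by rewrite lee_fin powR_ge0.
- by move=> t _; rewrite lee_fin powR_ge0.
- by apply/measurable_EFinP; apply: measurable_funTS; exact: measurable_abs_shift_powR.
- exact: (measurable_sphere hv).
rewrite integral_sphere_shift// vw -!EFinM -EFinD; congr EFin.
have Qm : Q `^ m%:~R = Q ^ m by rewrite powR_intmul ?ler0n.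
have e1 : (Q ^ m) `^ (- alpha - 1) = (Q `^ (m%:~R * alpha))^-1 * (Q ^ m)^-1.
  by rewrite powR_expz mulrBr mulr1 mulrN (q_powRD hv) !powRN Qm.
have e2 : (Q ^ m) `^ (alpha - 1) = Q `^ (m%:~R * alpha) * (Q ^ m)^-1.
  by rewrite powR_expz mulrBr mulr1 (q_powRD hv) powRN Qm.
have e3 : Q ^ (m + 1) = Q ^ m * Q by rewrite expfzDr ?expr1z// (q_neq0 hv).
rewrite e1 e2 e3 (powRN _ (m%:~R * alpha)).
have a1 : 1 - Q `^ (- alpha) != 0 by rewrite subr_eq0 gt_eqF// (q_powR_lt1 hv).
move: (q_neq0 hv) (gt_eqF (q_powR_gt0 hv (m%:~R * alpha))) (gt_eqF (q_expz_gt0 hv m)) a1.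
move: (Q `^ (m%:~R * alpha)) (Q ^ m) (Q `^ (- alpha)) => X M a Q0 /negbT X0 /negbT M0 a1.
by field; rewrite Q0 X0 M0 a1.
Qed.

(** Where [v t < v w] the second factor is the constant [v w `^ (alpha - 1)]; the
    rest of the domain is [composed_kernel_boundary]. *)
Lemma composed_kernel_outside (n : int) (w : K) : Q ^ n <= v w ->
  (\int[mu]_(t in far n) (v t `^ (- alpha - 1) * v ((t : K) + w)%R `^ (alpha - 1))%:E =
   (v w `^ (alpha - 1))%:E * \int[mu]_(t in far n) (v t `^ (- alpha - 1))%:E)%E.
Proof.
move=> nw; have [m vw] := abs_value hv (far_neq0 nw).
have nm : Q ^ n <= Q ^ m :> R by rewrite -vw.
have -> : far n = (far n `\` far m) `|` far m.
  rewrite setUC setDUK// => t; rewrite /far/=; exact: le_trans.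
have mD : measurable (far n `\` far m : set B).
  by apply: measurableD; exact: (measurable_far hv).
have dis : [disjoint far n `\` far m & far m].
  by apply/disj_setPS => t [[]].
rewrite ge0_integral_setU//; last 3 first.
- exact: (measurable_far hv).
- by apply: measurable_funTS; exact: measurable_composed_kernel.
- by move=> t _; rewrite lee_fin mulr_ge0// powR_ge0.
rewrite [in RHS]ge0_integral_setU//; last 3 first.
- exact: (measurable_far hv).
- by apply/measurable_EFinP; apply: measurable_funTS; exact: measurable_abs_powR.
- by move=> t _; rewrite lee_fin powR_ge0.
rewrite ge0_muleDr ?integral_ge0//; [|by move=> t _; rewrite lee_fin powR_ge0..].
congr (_ + _)%E; last exact: composed_kernel_boundary.
rewrite -(ge0_integralZl mu mD); first last.
- by rewrite lee_fin powR_ge0.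
- by move=> t _; rewrite lee_fin powR_ge0.
- by apply/measurable_EFinP; apply: measurable_funTS; exact: measurable_abs_powR.
apply: eq_integral => t; rewrite inE => -[_ /negP]; rewrite -ltNge -vw => tw.
by rewrite (absD_dominant hv)// mulrC.
Qed.

End Kernel.


(** * The kernel of the representation *)

(** The total mass of [kernelR1] as a rational function of [x = q `^ (- alpha)] and
    [Z = q]: the first term is the contribution of the power of [v tau], and the
    second one that of the constant. *)
Lemma kernel_mass_eq (F : realFieldType) (x Z : F) :
  0 < x -> x < 1 -> 1 < Z -> 1 < Z * x ->
  - ((1 - x^-1) / (1 - x / Z) * ((1 - x) / (1 - (Z * x)^-1))) *
    ((1 - Z^-1) / (1 - x)) * ((1 - Z^-1) * x / (1 - x)) -
  - ((1 - x^-1) / (1 - x / Z) * ((1 - x) / (1 - (Z * x)^-1))) / Z = 1.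
Proof.
move=> x0 x1 Z1 Zx1.
have xN : x != 0 by rewrite gt_eqF.
have ZN : Z != 0 by rewrite gt_eqF// (lt_trans ltr01).
have h1 : 1 - x != 0 by rewrite subr_eq0 gt_eqF.
have h2 : Z - x != 0 by rewrite subr_eq0 gt_eqF// (lt_trans x1).
have h3 : Z * x - 1 != 0 by rewrite subr_eq0 gt_eqF.
by field; rewrite xN ZN h1 h2 h3.
Qed.

Section KernelR.
Context {R : realType} {K : topologicalFieldType} {q : nat} {v : K -> R}.
Hypothesis hv : normalized_abs v q.
Context {mu : {measure set (borel K) -> \bar R}}.
Hypothesis hball : ball_measure v q mu.
Local Notation Q := (q%:R : R).
Local Notation B := (borel K).
Local Notation far := (@far R K q v).
Local Notation oball := (@oball R K q v).
Context {alpha : R}.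
Hypotheses (alpha0 : 0 < alpha) (alpha1 : alpha < 1).
Local Notation a := (Q `^ (- alpha)).
Local Notation kR := (kernelR v q alpha).
Local Notation kR1 := (kernelR1 v q alpha).

Let a_gt0 : 0 < a. Proof. exact: (q_powR_gt0 hv). Qed.
Let a_lt1 : a < 1. Proof. exact: (q_powR_lt1 hv alpha0). Qed.
Let Qa_gt1 : 1 < Q * a.
Proof.
have : Q `^ (- (1 - alpha)) < 1 by apply: (q_powR_lt1 hv); rewrite subr_gt0.
rewrite opprB (q_powRD hv) powR_inv1 ?ler0n// -[X in X / _]invrK -powRN -invfM.
by rewrite invf_lt1 ?mulr_gt0 ?(q_gt0 hv)// mulrC.
Qed.

Let Q_alpha : Q `^ alpha = a^-1. Proof. by rewrite powRN invrK. Qed.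
Let Q_alphaB1 : Q `^ (alpha - 1) = (Q * a)^-1.
Proof. by rewrite (q_powRD hv) powR_inv1 ?ler0n// Q_alpha invfM mulrC. Qed.
Let Q_alphaN1 : Q `^ (- alpha - 1) = a / Q.
Proof. by rewrite (q_powRD hv) powR_inv1 ?ler0n. Qed.

Lemma coef_lt0 : deriv_coef q alpha * riesz_coef q alpha < 0 :> R.
Proof.
rewrite /deriv_coef /riesz_coef Q_alphaB1 Q_alphaN1 Q_alpha.
rewrite nmulr_rlt0.
  by rewrite divr_gt0 ?subr_gt0 ?invf_lt1// (lt_trans ltr01).
rewrite nmulr_rlt0 ?invr_gt0 ?subr_lt0 ?invf_gt1// subr_gt0.
by rewrite ltr_pdivrMr ?(q_gt0 hv)// mul1r (lt_trans a_lt1)// (q_gt1 hv).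
Qed.

Let sup_coef : R := (1 - Q^-1) / (1 - a).

Let sup_coef_gt0 : 0 < sup_coef.
Proof. by rewrite divr_gt0 ?subr_gt0 ?invf_lt1 ?(q_gt1 hv) ?(q_gt0 hv). Qed.

Lemma kernelRE tau : kR tau = if 0 < v tau < 1 then 1 - sup_coef * v tau `^ (alpha - 1) else 0.
Proof. by []. Qed.

(** The power of [v tau] decreases, so the largest value of [kernelR] is taken at
    [v tau = q^-1], the largest absolute value below [1].  With [a = q `^ (- alpha)],
    the kernel is negative there because [q * a > 1]. *)
Lemma kernelR_lt0 tau : 0 < v tau -> v tau < 1 -> kR tau < 0.
Proof.
move=> t0 t1; rewrite kernelRE t0 t1/= subr_lt0.
have tQ : v tau <= Q^-1 by rewrite -(max_idealE hv).
have : Q * a <= v tau `^ (alpha - 1).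
  have Qinv : Q^-1 `^ (1 - alpha) = (Q * a)^-1.
    by rewrite -Q_alphaB1 -powR_inv1 ?ler0n// -powRrM mulN1r opprB.
  have : v tau `^ (1 - alpha) <= (Q * a)^-1.
    rewrite -Qinv; apply: ge0_ler_powR; rewrite ?nnegrE ?subr_ge0 ?invr_ge0 ?ler0n//.
    + exact: ltW.
    + exact: ltW.
  move=> h; rewrite -(opprB 1 alpha) (powRN (v tau)) -[X in X <= _]invrK lef_pV2// posrE.
    by rewrite invr_gt0 mulr_gt0// (q_gt0 hv).
  exact: powR_gt0.
move=> h; apply: (@lt_le_trans _ _ (sup_coef * (Q * a))); last first.
  by rewrite ler_wpM2l// ltW.
rewrite /sup_coef mulrAC ltr_pdivlMr ?subr_gt0// mul1r.
have -> : (1 - Q^-1) * (Q * a) = Q * a - a by field; exact: (q_neq0 hv).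
by rewrite ltrD2r.
Qed.

Lemma kernelR1_gt0 tau : 0 < v tau -> v tau < 1 -> 0 < kR1 tau.
Proof. by move=> t0 t1; rewrite /kernelR1 nmulr_lgt0 ?coef_lt0// kernelR_lt0. Qed.

Lemma kernelR1_ge0 tau : 0 <= kR1 tau.
Proof.
have [/andP[t0 t1]|/negbTE h] := boolP (0 < v tau < 1); first exact/ltW/kernelR1_gt0.
by rewrite /kernelR1 kernelRE h mulr0.
Qed.

Lemma measurable_kernelR : measurable_fun setT (kR : B -> R).
Proof.
apply: measurable_fun_ifT.
- apply: measurable_and; apply: measurable_fun_ltr => //; exact: (measurable_abs hv).
- apply: measurable_funB => //; apply: measurable_funM => //.
  exact: (measurable_abs_powR hv).
- exact: measurable_cst.
Qed.

(** Since [1 <= v tau `^ (alpha - 1)] on the support of the kernel, the kernel is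
    integrable wherever the Riesz kernel is. *)
Lemma kernelR_bound : exists C, 0 <= C /\ forall tau, `|kR tau| <= C * v tau `^ (alpha - 1).
Proof.
exists (1 + sup_coef); split; first by rewrite addr_ge0// ltW.
move=> tau; rewrite kernelRE; case: ifP => [/andP[t0 t1]|_]; last first.
  by rewrite normr0 mulr_ge0 ?powR_ge0// addr_ge0// ltW.
have p1 : 1 <= v tau `^ (alpha - 1).
  have : v tau `^ (1 - alpha) <= 1 `^ (1 - alpha).
    apply: ge0_ler_powR; rewrite ?nnegrE//.
    + by rewrite subr_ge0 ltW.
    + exact: ltW.
    + exact: ltW.
  by rewrite powR1 -(opprB 1 alpha) powRN invf_ge1// powR_gt0.
apply: le_trans (ler_normB _ _) _; rewrite normr1 mulrDl mul1r lerD//.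
by rewrite ger0_norm// mulr_ge0 ?powR_ge0// ltW.
Qed.

(** On the punctured open unit ball, the kernel plus a positive constant is a
    multiple of [v tau `^ (alpha - 1)].  In this form all the integrands are
    nonnegative. *)
Lemma integral_kernelR1 : (\int[mu]_tau (kR1 tau)%:E = 1)%E.
Proof.
set c := deriv_coef q alpha * riesz_coef q alpha : R.
(* The origin is removed because the kernel is set to [0] there. *)
pose P : set B := oball 0 `\` [set 0].
have m0 : measurable ([set 0] : set B) by exact: (borel_set1 hv).
have mN := measurable_oball hv 0.
have mP : measurable P by exact: measurableD.
have PE tau : (tau \in P) = (0 < v tau < 1).
  rewrite (abs_gt0 hv); apply/idP/idP; rewrite inE /P /oball/= expr0z.
    by case=> -> /eqP ->.
  by case/andP => /eqP.
have muP : mu P = (Q^-1)%:E.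
  rewrite /P measureD//; last first.
    rewrite (oball_cball hv); apply: le_lt_trans (ltry (Q ^ (0 - 1))).
    by rewrite -(hball 0 (0 - 1)).
  rewrite setIidr; last by move=> _ ->; rewrite /oball/= (abs0 hv) (q_expz_gt0 hv).
  transitivity ((Q^-1)%:E - 0)%E; last by rewrite sube0.
  congr (_ - _)%E; last exact: (ball_measure_set1 hv hball).
  by rewrite (oball_cball hv) sub0r -exprN1; exact: hball.
have restrP : (\int[mu]_tau (kR1 tau)%:E = \int[mu]_(tau in P) (kR1 tau)%:E)%E.
  rewrite [RHS]integral_mkcond; apply: eq_integral => tau _.
  rewrite /patch PE; case: ifPn => // /negbTE h.
  by rewrite /kernelR1 kernelRE h mulr0.
have intP : (\int[mu]_(tau in P) (v tau `^ (alpha - 1))%:E =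
    ((1 - Q^-1) * a / (1 - a))%:E)%E.
  transitivity (\int[mu]_(tau in oball 0) (v tau `^ (alpha - 1))%:E)%E.
    rewrite integral_mkcond [RHS]integral_mkcond; apply: eq_integral => tau _.
    rewrite /patch PE; case: ifPn => [/andP[t0 t1]|h]; case: ifPn => //.
      by rewrite notin_setE /oball/= expr0z => /(_ t1).
    rewrite inE /oball/= expr0z => t1; move: h; rewrite t1 andbT (abs_gt0 hv) negbK.
    by move=> /eqP ->; rewrite (abs0 hv) powR0// subr_eq0 lt_eqF.
  rewrite (integral_oball hv hball)// ?lt_eqF//; congr EFin.
  by rewrite sub0r mulN1r.
have mkR1 : measurable_fun setT (fun tau : B => (kR1 tau)%:E).
  by apply/measurable_EFinP; apply: measurable_funM => //; exact: measurable_kernelR.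
have mv : measurable_fun setT (fun tau : B => (v tau `^ (alpha - 1))%:E).
  by apply/measurable_EFinP; exact: (measurable_abs_powR hv).
have c0 : 0 <= - c by rewrite oppr_ge0 ltW// coef_lt0.
have : (\int[mu]_(tau in P) (kR1 tau)%:E + \int[mu]_(tau in P) (- c)%:E =
   \int[mu]_(tau in P) ((- c * sup_coef)%:E * (v tau `^ (alpha - 1))%:E))%E.
  rewrite -ge0_integralD//; last 2 first.
  - by move=> tau _; rewrite lee_fin kernelR1_ge0.
  - exact: measurable_funTS.
  apply: eq_integral => tau; rewrite PE -EFinM -EFinD => tP; congr EFin.
  by rewrite /kernelR1 kernelRE tP -/c; ring.
rewrite ge0_integralZl//; last 3 first.
- exact: measurable_funTS.
- by move=> tau _; rewrite lee_fin powR_ge0.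
- by rewrite lee_fin mulr_ge0// ltW.
rewrite restrP intP integral_cst// muP -!EFinM.
move=> h; transitivity ((- c * sup_coef * ((1 - Q^-1) * a / (1 - a)))%:E - (- c / Q)%:E)%E.
  by rewrite -h addeK.
rewrite -EFinB; congr EFin.
rewrite /c /deriv_coef /riesz_coef /sup_coef Q_alphaB1 Q_alphaN1 Q_alpha.
exact: kernel_mass_eq a_gt0 a_lt1 (q_gt1 hv) Qa_gt1.
Qed.

End KernelR.


Definition trunc_weight {R : realType} {K : topologicalFieldType} (v : K -> R)
    (q : nat) (alpha : R) (n : int) (t : K) : R :=
  if q%:R ^ n <= v t then v t `^ (- alpha - 1) else 0.

Definition trunc_mass {R : realType} (q : nat) (alpha : R) (n : int) : R :=
  (1 - q%:R^-1) * q%:R `^ (- (n%:~R * alpha)) / (1 - q%:R `^ (- alpha)).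

Section Composition.
Context {R : realType} {K : topologicalFieldType} {q : nat} {v : K -> R}.
Hypothesis hv : normalized_abs v q.
Context {mu : {measure set (borel K) -> \bar R}}.
Hypothesis hball : ball_measure v q mu.
Local Notation Q := (q%:R : R).
Local Notation B := (borel K).
Local Notation far := (@far R K q v).
Context {alpha : R}.
Hypotheses (alpha0 : 0 < alpha) (alpha1 : alpha < 1).
Local Notation tw := (trunc_weight v q alpha).
Local Notation S := (trunc_mass q alpha).

Lemma trunc_weight_ge0 n t : 0 <= tw n t.
Proof. by rewrite /trunc_weight; case: ifP => // _; exact: powR_ge0. Qed.

Lemma measurable_trunc_weight n : measurable_fun setT (tw n : B -> R).
Proof.
apply: measurable_fun_ifT => //; last exact: (measurable_abs_powR hv).
by apply: measurable_fun_ler => //; exact: (measurable_abs hv).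
Qed.

Lemma trunc_weight_patch n (f : B -> R) :
  (fun t => (tw n t * f t)%:E) = (fun t => (v t `^ (- alpha - 1) * f t)%:E) \_ (far n).
Proof.
apply/funext => t; rewrite /trunc_weight /patch.
have -> : (t \in far n) = (Q ^ n <= v t) by apply/idP/idP; rewrite inE.
by case: ifP => // _; rewrite mul0r.
Qed.

Lemma integral_trunc_weight n (x : K) :
  (\int[mu]_y (tw n ((y : K) - x)%R)%:E = (S n)%:E)%E.
Proof.
have mF : measurable_fun setT (fun t : B => (tw n t)%:E).
  by apply/measurable_EFinP; exact: measurable_trunc_weight.
have := ge0_integral_affine hv hball (- x) (oner_neq0 K) mF.
rewrite (abs1 hv) invr1 mul1e => h.
transitivity (\int[mu]_t (tw n t)%:E)%E.
  rewrite -h; last by move=> t; rewrite lee_fin trunc_weight_ge0.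
  by apply: eq_integral => t _; rewrite mul1r.
rewrite -(integral_far hv hball n alpha0) [RHS]integral_mkcond.
rewrite (_ : _ \_ _ = (fun t => (tw n t * 1)%:E)); last first.
  by rewrite trunc_weight_patch; congr (_ \_ _); apply/funext => t; rewrite mulr1.
by apply: eq_integral => t _; rewrite mulr1.
Qed.

(** The term with [trunc_mass] is the one that the subtraction of [u x] in the
    difference quotient cancels.  The point [z = x] is excluded since there the
    right-hand side is [0] by the conventions on powers of [0]. *)
Lemma kernel_composition (n : int) (sigma x z : K) : v sigma = Q ^ n -> x != z ->
  (\int[mu]_y (tw n ((y : K) - x)%R * v ((y : K) - z)%R `^ (alpha - 1))%:E =
   (S n * v (x - z)%R `^ (alpha - 1) +
    (Q ^ n)^-1 * kernelR v q alpha ((x - z) / sigma))%:E)%E.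
Proof.
move=> vs xz; set w := x - z.
have w0 : w != 0 by rewrite subr_eq0.
pose F (t : B) : \bar R := (tw n t * v ((t : K) + w) `^ (alpha - 1))%:E.
have mF : measurable_fun setT F.
  apply/measurable_EFinP; apply: measurable_funM; first exact: measurable_trunc_weight.
  exact: (measurable_abs_shift_powR hv).
have F0 t : (0 <= F t)%E by rewrite lee_fin mulr_ge0 ?trunc_weight_ge0 ?powR_ge0.
have := ge0_integral_affine hv hball (- x) (oner_neq0 K) mF F0.
rewrite (abs1 hv) invr1 mul1e => h.
transitivity (\int[mu]_t F t)%E.
  rewrite -h; apply: eq_integral => y _; rewrite mul1r /F; congr (_ * v _ `^ _)%:E.
  by rewrite /w; ring.
rewrite /F trunc_weight_patch -integral_mkcond; clear h mF F0 F.
rewrite kernelRE (absM hv) (absV hv) vs.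
have Qn := q_expz_gt0 hv n.
have vw : 0 < v w by rewrite (abs_gt0 hv).
rewrite divr_gt0//= ltr_pdivrMr// mul1r.
case: ifPn => wn; last first.
  rewrite -leNgt in wn; rewrite (composed_kernel_outside hv hball)//.
  by rewrite (integral_far hv hball)// mulr0 addr0 -EFinM mulrC.
rewrite (composed_kernel_inside hv hball)//; congr EFin.
rewrite powRM ?ltW ?invr_gt0//.
have -> : (Q ^ n)^-1 `^ (alpha - 1) = Q ^ n * Q `^ (- (n%:~R * alpha)).
  rewrite -powR_intmul ?ler0n// -powRN -powRrM -(q_powRD hv); congr (_ `^ _); ring.
rewrite /trunc_mass.
have e : (Q ^ n)^-1 * Q ^ n = 1 by rewrite mulVf// gt_eqF.
rewrite mulrBr mulr1 addrCA -[LHS]addr0; congr (_ + _).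
apply/eqP; rewrite eq_sym subr_eq0; apply/eqP.
transitivity (((Q ^ n)^-1 * Q ^ n) * ((1 - Q^-1) * (1 - Q `^ (- alpha))^-1 *
    (v w `^ (alpha - 1) * Q `^ (- (n%:~R * alpha))))).
  by rewrite e; ring.
ring.
Qed.

End Composition.


(** * Almost everywhere convergence of the Riesz potential *)

Definition near_weight {R : realType} {K : topologicalFieldType} (v : K -> R)
    (alpha : R) (t : K) : R := if v t < 1 then v t `^ (alpha - 1) else 0.

(** A substitute for the inequality of Hoelder: if [N <= r `^ (- p^-1)], the first
    term on the right dominates the left-hand side; otherwise
    [N `^ (p - 1) >= r `^ (alpha - 1)], and the second one does. *)
Lemma powR_mul_le {R : realType} (alpha p r N : R) :
  1 <= p -> alpha <= p^-1 -> 1 <= r -> 0 <= N ->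
  r `^ (alpha - 1) * N <= r `^ (- (p^-1 - alpha) - 1) + N `^ p.
Proof.
move=> p1 ap r1 N0.
have r0 : 0 < r by exact: lt_le_trans r1.
have p0 : 0 < p by exact: lt_le_trans p1.
have [Nr|/ltW rN] := leP N (r `^ (- p^-1)).
  rewrite ler_wpDr ?powR_ge0//.
  rewrite (_ : - (p^-1 - alpha) - 1 = (alpha - 1) + - p^-1); last by ring.
  rewrite (@powRD _ r (alpha - 1) (- p^-1)) ?(gt_eqF r0) ?implybT//.
  by rewrite ler_wpM2l// powR_ge0.
rewrite ler_wpDl ?powR_ge0// -(mulr_powRB1 N0 p0) mulrC ler_wpM2l//.
apply: (@le_trans _ _ ((r `^ (- p^-1)) `^ (p - 1))); last first.
  by apply: ge0_ler_powR; rewrite ?nnegrE ?powR_ge0 ?subr_ge0.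
rewrite -powRrM; apply: ler_powR => //.
rewrite mulNr mulrBr mulVf ?gt_eqF// mulr1; lra.
Qed.

Lemma le1D_powR {R : realType} (p N : R) : 1 <= p -> 0 <= N -> N <= 1 + N `^ p.
Proof.
move=> p1 N0; have [N1|/ltW N1] := leP N 1; first by rewrite ler_wpDr ?powR_ge0.
by rewrite ler_wpDl// le1r_powR.
Qed.

Section Finiteness.
Context {R : realType} {K : topologicalFieldType} {q : nat} {v : K -> R}.
Hypothesis hv : normalized_abs v q.
Local Notation B := (borel K).
Context {mu : {sigma_finite_measure set (borel K) -> \bar R}}.
Hypothesis hball : ball_measure v q mu.
Local Notation Q := (q%:R : R).
Context {alpha : R}.
Hypotheses (alpha0 : 0 < alpha) (alpha1 : alpha < 1).
Local Notation nw := (near_weight v alpha).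
Local Notation oball := (@oball R K q v).

Lemma near_weight_ge0 t : 0 <= nw t.
Proof. by rewrite /near_weight; case: ifP => // _; exact: powR_ge0. Qed.

Lemma measurable_near_weight : measurable_fun setT (nw : B -> R).
Proof.
apply: measurable_fun_ifT => //; last exact: (measurable_abs_powR hv).
by apply: measurable_fun_ltr => //; exact: (measurable_abs hv).
Qed.

Lemma measurable_fun_sub (h : B -> R) : measurable_fun setT h ->
  measurable_fun setT (fun z : B * B => h ((z.1 : K) - (z.2 : K))).
Proof. by move=> mh; exact: (measurableT_comp mh (measurable_sub hv)). Qed.

Lemma measurable_riesz_kernel (e : R) (x : K) :
  measurable_fun setT (fun y : B => v (x - (y : K)) `^ e).
Proof.
rewrite (_ : (fun _ => _) = (fun y : B => v ((y : K) - x) `^ e)).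
  exact: (measurable_abs_shift_powR hv).
by apply/funext => y; rewrite (abs_distC hv).
Qed.

Lemma integral_near_weight : exists c : R, forall x : K,
  (\int[mu]_y (nw ((y : K) - x)%R)%:E = c%:E)%E.
Proof.
eexists => x.
have mF : measurable_fun setT (fun t : B => (nw t)%:E).
  by apply/measurable_EFinP; exact: measurable_near_weight.
have := ge0_integral_affine hv hball (- x) (oner_neq0 K) mF.
rewrite (abs1 hv) invr1 mul1e => h.
transitivity (\int[mu]_t (nw t)%:E)%E.
  rewrite -h; last by move=> t; rewrite lee_fin near_weight_ge0.
  by apply: eq_integral => t _; rewrite mul1r.
transitivity (\int[mu]_(t in oball 0) (v t `^ (alpha - 1))%:E)%E.
  rewrite [RHS]integral_mkcond; apply: eq_integral => t _.
  rewrite /patch /near_weight.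
  have -> : (t \in oball 0) = (v t < 1).
    by apply/idP/idP; rewrite inE /oball/= expr0z.
  by case: ifP.
by rewrite (integral_oball hv hball)// lt_eqF.
Qed.

(** On [v (x - y) < 1], bound [N] by [1 + N `^ p]: the kernel is integrable there,
    and its convolution with [N `^ p] is finite almost everywhere by Tonelli's
    theorem.  On the complement use [powR_mul_le], whose first term is a truncated
    power with exponent [s = p^-1 - alpha > 0]. *)
Lemma riesz_integrable_ae (p : R) (N : B -> R) :
  1 <= p -> p < alpha^-1 -> measurable_fun setT N -> (forall y, 0 <= N y) ->
  (\int[mu]_y (N y `^ p)%:E < +oo)%E ->
  {ae mu, forall x : B,
    (\int[mu]_y (v ((x : K) - (y : K))%R `^ (alpha - 1) * N y)%:E < +oo)%E}.
Proof.
move=> p1 pa mN N0 Np.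
have p0 : 0 < p by exact: lt_le_trans p1.
have ap : alpha < p^-1 by rewrite -[alpha]invrK ltf_pV2 ?posrE// invr_gt0.
have [c hc] := integral_near_weight.
have c0 : 0 <= c.
  by rewrite -lee_fin -(hc 0) integral_ge0// => y _; rewrite lee_fin near_weight_ge0.
have mNp : measurable_fun setT (fun y : B => N y `^ p).
  exact: (measurableT_comp (measurable_powR p) mN).
pose s := p^-1 - alpha; have s0 : 0 < s by rewrite subr_gt0.
pose H (z : B * B) : \bar R := (nw ((z.1 : K) - (z.2 : K)) * N z.2 `^ p)%:E.
have mH : measurable_fun setT H.
  apply/measurable_EFinP; apply: measurable_funM.
    exact: (measurable_fun_sub measurable_near_weight).
  exact: (measurableT_comp mNp measurable_snd).
have H0 z : (0 <= H z)%E by rewrite lee_fin mulr_ge0 ?near_weight_ge0 ?powR_ge0.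
have Hfin : {ae mu, forall x : B, (\int[mu]_y H (x, y) < +oo)%E}.
  have HI : mu.-integrable setT (fun x => \int[mu]_y H (x, y))%E.
    apply/integrableP; split; first exact: (measurable_fun_fubini_tonelli_F H).
    under eq_integral do rewrite gee0_abs ?integral_ge0//.
    rewrite (fubini_tonelli H)//.
    rewrite (eq_integral (fun y : B => c%:E * (N y `^ p)%:E)%E); last first.
      move=> y _; rewrite /fubini_G /H/= -(hc y).
      under eq_integral do rewrite EFinM.
      rewrite ge0_integralZr//.
      - by apply/measurable_EFinP; apply: (measurableT_comp measurable_near_weight);
           exact: (measurable_shift hv).
      - by move=> x _; rewrite lee_fin near_weight_ge0.
      - by rewrite lee_fin powR_ge0.
    rewrite ge0_integralZl//.
    - by rewrite lte_mul_pinfty// lee_fin.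
    - exact/measurable_EFinP.
    - by move=> y _; rewrite lee_fin powR_ge0.
  move/integrable_ae: HI => /(_ measurableT); apply: filterS => x /(_ I).
  by rewrite fin_numElt => /andP[].
apply: filterS Hfin => x Hx.
have md (h : B -> R) : measurable_fun setT h ->
    measurable_fun setT (fun y : B => (h ((y : K) - x))%:E).
  move=> mh; apply/measurable_EFinP; apply: (measurableT_comp mh).
  exact: (measurable_shift hv).
have mn := md _ measurable_near_weight.
have mt := md _ (measurable_trunc_weight hv (alpha := s) 0).
have mHx : measurable_fun setT (fun y : B => H (x, y)).
  by apply: (measurableT_comp mH); exact: measurable_pair1.
have mNpE : measurable_fun setT (fun y : B => (N y `^ p)%:E) by exact/measurable_EFinP.
apply: (@le_lt_trans _ _ (\int[mu]_y (((nw ((y : K) - x)%R)%:E +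
    (trunc_weight v q s 0 ((y : K) - x)%R)%:E) + (H (x, y) + (N y `^ p)%:E)))%E).
  apply: ge0_le_integral => //.
  - by move=> y _; rewrite lee_fin mulr_ge0 ?powR_ge0.
  - apply/measurable_EFinP; apply: measurable_funM => //.
    exact: measurable_riesz_kernel.
  - by apply: emeasurable_funD; apply: emeasurable_funD.
  - move=> y _; rewrite /H/= -!EFinD lee_fin /near_weight /trunc_weight expr0z.
    rewrite (abs_distC hv y x).
    have [r1|r1] := leP 1 (v (x - y)).
      by rewrite mul0r !add0r; apply: powR_mul_le => //; exact: ltW.
    rewrite addr0 addrA ler_wpDr ?powR_ge0//.
    rewrite -{2}[v (x - y) `^ (alpha - 1)]mulr1 -mulrDr.
    by rewrite ler_wpM2l ?powR_ge0// le1D_powR.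
rewrite ge0_integralD//; first last.
- exact: emeasurable_funD.
- by move=> y _; rewrite adde_ge0// lee_fin powR_ge0.
- exact: emeasurable_funD.
- by move=> y _; rewrite adde_ge0// lee_fin ?near_weight_ge0 ?trunc_weight_ge0.
rewrite ge0_integralD//; first last.
- by move=> y _; rewrite lee_fin trunc_weight_ge0.
- by move=> y _; rewrite lee_fin near_weight_ge0.
rewrite ge0_integralD//; last by move=> y _; rewrite lee_fin powR_ge0.
rewrite hc (integral_trunc_weight hv hball s0).
by apply: lte_add_pinfty; [rewrite -EFinD ltry|exact: lte_add_pinfty].
Qed.

End Finiteness.


(** * The representation for real-valued densities *)

Lemma ae_eq_integrable d (T : measurableType d) (R : realType)
    (mu : {measure set T -> \bar R}) (f g : T -> \bar R) :
  measurable_fun setT g -> ae_eq mu setT f g ->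
  mu.-integrable setT f -> mu.-integrable setT g.
Proof.
move=> mg fg /integrableP[mf foo]; apply/integrableP; split => //.
rewrite (_ : (\int[mu]_x `|g x| = \int[mu]_x `|f x|)%E)//.
apply: ge0_ae_eq_integral => //; [exact: measurableT_comp..|].
by move: fg; apply: filterS => x /= h /h ->.
Qed.

Section Representation.
Context {R : realType} {K : topologicalFieldType} {q : nat} {v : K -> R}.
Hypothesis hv : normalized_abs v q.
Local Notation B := (borel K).
Context {mu : {sigma_finite_measure set (borel K) -> \bar R}}.
Hypothesis hball : ball_measure v q mu.
Local Notation Q := (q%:R : R).
Context {alpha : R}.
Hypotheses (alpha0 : 0 < alpha) (alpha1 : alpha < 1).
Local Notation tw := (trunc_weight v q alpha).
Local Notation S := (trunc_mass q alpha).
Local Notation kR := (kernelR v q alpha).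
Context {f : B -> R}.
Hypothesis mf : measurable_fun setT f.

Definition real_riesz (y : K) : R := \int[mu]_z (v (y - (z : K)) `^ (alpha - 1) * f z).
Local Notation U := real_riesz.

Lemma measurable_riesz_integrand : measurable_fun setT
  (fun z : B * B => (v ((z.1 : K) - (z.2 : K)) `^ (alpha - 1) * f z.2)%:E).
Proof.
apply/measurable_EFinP; apply: measurable_funM.
  exact: (measurable_fun_sub hv (measurable_abs_powR hv (alpha - 1))).
exact: (measurableT_comp mf measurable_snd).
Qed.

(** The potential is the value by [fine] of an extended real integral that may
    fail to converge, so that measurability has to be read on its positive and
    negative parts. *)
Lemma measurable_real_riesz : measurable_fun setT (U : B -> R).
Proof.
pose h (z : B * B) := (v ((z.1 : K) - (z.2 : K)) `^ (alpha - 1) * f z.2)%:E.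
have mh : measurable_fun setT h by exact: measurable_riesz_integrand.
have -> : (U : B -> R) = fine \o ((fun y => \int[mu]_z h^\+%E (y, z)) \-
                        (fun y => \int[mu]_z h^\-%E (y, z)))%E.
  apply/funext => y; rewrite /real_riesz /Rintegral integralE; congr (fine (_ - _)%E).
    by apply: eq_integral => z _; rewrite !funeposE.
  by apply: eq_integral => z _; rewrite !funenegE.
apply: measurableT_comp => //; apply: emeasurable_funB.
  exact: (measurable_fun_fubini_tonelli_F _ (measurable_funepos mh) (funepos_ge0 h)).
exact: (measurable_fun_fubini_tonelli_F _ (measurable_funeneg mh) (funeneg_ge0 h)).
Qed.

Context {n : int} {sigma x : K}.
Hypothesis vs : v sigma = Q ^ n.
Hypothesis hfin : (\int[mu]_z (v (x - (z : K))%R `^ (alpha - 1) * `|f z|)%:E < +oo)%E.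

Let Qn := q_expz_gt0 hv n.
Let sigma0 : sigma != 0.
Proof. by rewrite -(abs_gt0 hv) vs. Qed.

Lemma riesz_integrand_integrable :
  mu.-integrable setT (fun z : B => (v (x - (z : K)) `^ (alpha - 1) * f z)%:E).
Proof.
apply/integrableP; split.
  by apply/measurable_EFinP; apply: measurable_funM => //; exact: (measurable_riesz_kernel hv).
by under eq_integral do rewrite /= normrM (ger0_norm (powR_ge0 _ _)).
Qed.

Lemma measurable_kernelR_shift :
  measurable_fun setT (fun z : B => kR ((x - (z : K)) / sigma)).
Proof.
have s0 : - sigma^-1 != 0 by rewrite oppr_eq0 invr_eq0.
rewrite (_ : (fun _ => _) = (fun z : B => kR ((- sigma^-1) * (z : K) + x / sigma))).
  by apply: (measurableT_comp (measurable_kernelR hv)); exact: (measurable_affine hv).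
by apply/funext => z; congr kernelR; ring.
Qed.

Lemma kernelR_integrand_integrable :
  mu.-integrable setT (fun z : B => (kR ((x - (z : K)) / sigma) * f z)%:E).
Proof.
have [C [C0 hC]] := kernelR_bound hv alpha0 alpha1.
pose D := C * (v sigma)^-1 `^ (alpha - 1).
have D0 : 0 <= D by rewrite mulr_ge0 ?powR_ge0.
apply: (le_integrable _ _ _ (integrableZl _ D riesz_integrand_integrable)) => //.
  by apply/measurable_EFinP; apply: measurable_funM => //; exact: measurable_kernelR_shift.
move=> z _; rewrite /= lee_fin.
have -> : `|D * (v (x - z) `^ (alpha - 1) * f z)| = D * v (x - z) `^ (alpha - 1) * `|f z|.
  by rewrite !normrM (ger0_norm C0) !(ger0_norm (powR_ge0 _ _)) mulrA.
rewrite normrM ler_wpM2r//.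
apply: le_trans (hC _) _; rewrite (absM hv) (absV hv) powRM ?invr_ge0 ?(abs_ge0 hv)//.
by rewrite /D -mulrA [X in C * X]mulrC.
Qed.

(** The substitution [z = x - sigma * tau]. *)
Lemma kernelR_change :
  mu.-integrable setT (fun tau : B => (kR tau * f (x - sigma * (tau : K)))%:E) /\
  \int[mu]_tau (kR tau * f (x - sigma * (tau : K))) =
  (Q ^ n)^-1 * \int[mu]_z (kR ((x - (z : K)) / sigma) * f z).
Proof.
have s0 : - sigma != 0 by rewrite oppr_eq0.
pose F (z : B) := (kR ((x - (z : K)) / sigma) * f z)%:E.
have FE : (fun tau : B => (kR tau * f (x - sigma * (tau : K)))%:E) =
          (fun tau : B => F (- sigma * (tau : K) + x)).
  apply/funext => tau; rewrite /F; congr (_ * _)%:E.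
    by congr kernelR; field.
  by congr f; ring.
split; first by rewrite FE; exact: (integrable_affine hv hball x s0 kernelR_integrand_integrable).
have := integral_affine hv hball x s0 kernelR_integrand_integrable.
rewrite (absN hv) vs => h.
transitivity (fine (((Q ^ n)^-1)%:E * \int[mu]_z F z)%E).
  rewrite -h; congr fine; apply: eq_integral => tau _.
  exact: (congr1 (fun g => g tau) FE).
by rewrite fineM//; exact: (integrable_fin_num _ kernelR_integrand_integrable).
Qed.

(** The kernel produced by integrating first over the variable of [u]. *)
Let M (z : K) : R := S n * v (x - z) `^ (alpha - 1) + (Q ^ n)^-1 * kR ((x - z) / sigma).

Let Mf_split z : (M z * f z)%:E = ((S n)%:E * (v (x - z) `^ (alpha - 1) * f z)%:E +
  ((Q ^ n)^-1)%:E * (kR ((x - z) / sigma) * f z)%:E)%E.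
Proof. by rewrite -!EFinM -EFinD; congr EFin; rewrite /M; ring. Qed.

Let Mf_integrable : mu.-integrable setT (fun z : B => (M z * f z)%:E).
Proof.
rewrite (_ : (fun _ => _) = (fun z => ((S n)%:E * (v (x - z) `^ (alpha - 1) * f z)%:E +
  ((Q ^ n)^-1)%:E * (kR ((x - z) / sigma) * f z)%:E)%E)); last exact/funext/Mf_split.
by apply: integrableD => //; apply: integrableZl => //;
  [exact: riesz_integrand_integrable|exact: kernelR_integrand_integrable].
Qed.

Let G (yz : B * B) : \bar R :=
  (tw n ((yz.1 : K) - x) * (v ((yz.1 : K) - (yz.2 : K)) `^ (alpha - 1) * f yz.2))%:E.

Let mG : measurable_fun setT G.
Proof.
apply/measurable_EFinP; apply: measurable_funM; last first.
  by apply/measurable_EFinP; exact: measurable_riesz_integrand.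
have mt : measurable_fun setT (fun y : B => tw n ((y : K) - x)).
  exact: (measurableT_comp (measurable_trunc_weight hv n) (measurable_shift hv (- x))).
exact: (measurableT_comp mt measurable_fst).
Qed.

Let tw_kernel_measurable (z : K) : measurable_fun setT
  (fun y : B => (tw n ((y : K) - x) * v ((y : K) - z) `^ (alpha - 1))%:E).
Proof.
apply/measurable_EFinP; apply: measurable_funM; last exact: (measurable_abs_shift_powR hv).
exact: (measurableT_comp (measurable_trunc_weight hv n) (measurable_shift hv (- x))).
Qed.

(** As in [kernel_composition], [z = x] is excluded; it is a null set. *)
Let G_inner z : x != z -> (\int[mu]_y G (y, z) = (M z * f z)%:E)%E.
Proof.
move=> xz; rewrite EFinM -(kernel_composition hv hball alpha0 alpha1 vs xz).
rewrite -integralZr//; last first.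
  apply/integrableP; split; first exact: tw_kernel_measurable.
  under eq_integral do rewrite gee0_abs ?lee_fin ?mulr_ge0 ?trunc_weight_ge0 ?powR_ge0//.
  by rewrite (kernel_composition hv hball alpha0 alpha1 vs xz) ltry.
by apply: eq_integral => y _; rewrite /G/= -EFinM mulrA.
Qed.

Let Gabs_inner z : x != z -> (\int[mu]_y `|G (y, z)| = (`|M z * f z|)%:E)%E.
Proof.
move=> xz.
have M0 : (0 <= (M z)%:E)%E.
  rewrite -(kernel_composition hv hball alpha0 alpha1 vs xz) integral_ge0// => y _.
  by rewrite lee_fin mulr_ge0 ?trunc_weight_ge0 ?powR_ge0.
rewrite normrM (ger0_norm M0) EFinM -(kernel_composition hv hball alpha0 alpha1 vs xz).
rewrite -ge0_integralZr//.
  apply: eq_integral => y _; rewrite /G/= -EFinM !normrM mulrA.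
  by rewrite (ger0_norm (trunc_weight_ge0 _ _)) (ger0_norm (powR_ge0 _ _)).
by move=> y _; rewrite lee_fin mulr_ge0 ?trunc_weight_ge0 ?powR_ge0.
Qed.

Let neq_ae : {ae mu, forall z : B, x != z}.
Proof.
exists [set x]; split; [exact: (borel_set1 hv)|exact: (ball_measure_set1 hv hball)|].
by move=> z /= /negP; rewrite negbK => /eqP ->.
Qed.

Let G_integrable : (mu \x mu)%E.-integrable setT G.
Proof.
apply: (integrable21ltyP mu mu mG).2.
rewrite (_ : (\int[mu]_z \int[mu]_y `|G (y, z)| = \int[mu]_z `|(M z * f z)%:E|)%E).
  by have /integrableP[] := Mf_integrable.
apply: ge0_ae_eq_integral => //.
- apply: (measurable_fun_fubini_tonelli_G (abse \o G)) => //=.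
  exact: measurableT_comp.
- by apply: measurableT_comp => //; exact: measurable_int Mf_integrable.
- by move=> z _; apply: integral_ge0.
by apply: filterS neq_ae => z xz _; rewrite Gabs_inner.
Qed.

(** The potential [U y] is defined by a convergent integral only for almost every
    [y]; where the weight vanishes both sides are [0], and elsewhere the
    integrability of [G] in [z] is that of the Riesz integrand. *)
Let F_ae : ae_eq mu setT (fun y : B => \int[mu]_z G (y, z))%E
  (fun y : B => (tw n ((y : K) - x) * U y)%:E).
Proof.
apply: filterS (ae_integrable1 G_integrable) => y Gy _.
have [t0|t0] := eqVneq (tw n (y - x)) 0.
  rewrite t0 mul0r; under eq_integral do rewrite /G/= t0 mul0r.
  by rewrite integral0.
have iy : mu.-integrable setT (fun z : B => (v ((y : K) - z) `^ (alpha - 1) * f z)%:E).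
  rewrite (_ : (fun _ => _) = (fun z => ((tw n ((y : K) - x))^-1)%:E * G (y, z))%E).
    exact: integrableZl.
  by apply/funext => z; rewrite /G/= -EFinM mulKf.
rewrite EFinM /real_riesz /Rintegral fineK; last exact: integrable_fin_num iy.
by rewrite -integralZl//.
Qed.

Lemma trunc_riesz_integrable :
  mu.-integrable setT (fun y : B => (tw n ((y : K) - x) * U y)%:E).
Proof.
apply: (ae_eq_integrable _ F_ae); last exact: (integrable_fubini_F G_integrable).
apply/measurable_EFinP; apply: measurable_funM; last exact: measurable_real_riesz.
exact: (measurableT_comp (measurable_trunc_weight hv n) (measurable_shift hv (- x))).
Qed.

(** Fubini's theorem exchanges the integral defining the potential with the
    truncated integral. *)
Lemma trunc_riesz_integral :
  \int[mu]_y (tw n ((y : K) - x) * U y) =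
  S n * U x + (Q ^ n)^-1 * \int[mu]_z (kR ((x - (z : K)) / sigma) * f z).
Proof.
have e : (\int[mu]_y (tw n ((y : K) - x)%R * U y)%:E = \int[mu]_z (M z * f z)%:E)%E.
  transitivity (\int[mu]_y \int[mu]_z G (y, z))%E.
    apply/esym; apply: ae_eq_integral => //.
    - exact: (measurable_fubini_F G_integrable).
    - exact: (measurable_int _ trunc_riesz_integrable).
  rewrite (Fubini G_integrable); apply: ae_eq_integral => //.
  - exact: (measurable_fubini_G G_integrable).
  - exact: (measurable_int _ Mf_integrable).
  by apply: filterS neq_ae => z xz _; rewrite G_inner.
rewrite /Rintegral e -/(Rintegral _ _ _).
have r1 := riesz_integrand_integrable; have r2 := kernelR_integrand_integrable.
transitivity (\int[mu]_z (S n * (v (x - (z : K)) `^ (alpha - 1) * f z) +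
   (Q ^ n)^-1 * (kR ((x - (z : K)) / sigma) * f z))).
  by apply: eq_Rintegral => z _; rewrite /M; ring.
rewrite RintegralD//; [|exact: integrableZl r1|exact: integrableZl r2].
by rewrite !RintegralZl.
Qed.

End Representation.


Section RealDifference.
Context {R : realType} {K : topologicalFieldType} {q : nat} {v : K -> R}.
Hypothesis hv : normalized_abs v q.
Local Notation B := (borel K).
Context {mu : {sigma_finite_measure set (borel K) -> \bar R}}.
Hypothesis hball : ball_measure v q mu.
Local Notation Q := (q%:R : R).
Context {alpha : R}.
Hypotheses (alpha0 : 0 < alpha) (alpha1 : alpha < 1).
Local Notation tw := (trunc_weight v q alpha).
Local Notation kR := (kernelR v q alpha).
Context {f : B -> R}.
Hypothesis mf : measurable_fun setT f.
Local Notation U := (@real_riesz R K v mu alpha f).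
Context {n : int} {sigma x : K}.
Hypothesis vs : v sigma = Q ^ n.
Hypothesis hfin : (\int[mu]_z (v (x - (z : K))%R `^ (alpha - 1) * `|f z|)%:E < +oo)%E.

Lemma measurable_trunc_domain : measurable (trunc_domain v (Q ^ n) x : set B).
Proof.
have := measurable_shift hv (- x) measurableT (measurable_far hv n).
by rewrite setTI.
Qed.

Lemma trunc_difference_patch (d : R) (y : B) :
  ((fun y => (d * U y - d * U x) / v ((y : K) - x) `^ (alpha + 1)) \_
    (trunc_domain v (Q ^ n) x)) y =
  d * (tw n ((y : K) - x) * U y) - (d * U x) * tw n ((y : K) - x).
Proof.
rewrite /patch /trunc_weight.
have -> : (y \in trunc_domain v (Q ^ n) x) = (Q ^ n <= v ((y : K) - x)).
  by apply/idP/idP; rewrite inE.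
case: ifP => _; last by rewrite mul0r !mulr0 subr0.
have -> : - alpha - 1 = - (alpha + 1) by ring.
rewrite powRN; move: (U y) (U x) => b a; ring.
Qed.

Let mass_integrable : mu.-integrable setT (fun y : B => (tw n ((y : K) - x))%:E).
Proof.
apply/integrableP; split.
  apply/measurable_EFinP.
  exact: (measurableT_comp (measurable_trunc_weight hv n) (measurable_shift hv (- x))).
under eq_integral do rewrite gee0_abs ?lee_fin ?trunc_weight_ge0//.
by rewrite (integral_trunc_weight hv hball alpha0) ltry.
Qed.

(** Both terms of the difference quotient are integrable separately, because the
    truncation removes the singularity. *)
Lemma trunc_difference (d : R) :
  mu.-integrable (trunc_domain v (Q ^ n) x)
    (fun y : B => ((d * U y - d * U x) / v ((y : K) - x) `^ (alpha + 1))%:E) /\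
  \int[mu]_(y in trunc_domain v (Q ^ n) x)
    ((d * U y - d * U x) / v ((y : K) - x) `^ (alpha + 1)) =
  d * \int[mu]_tau (kR tau * f (x - sigma * (tau : K))).
Proof.
have i1 := trunc_riesz_integrable hv hball alpha0 alpha1 mf vs hfin.
have i1' := integrableZl measurableT d i1.
have i2' := integrableZl measurableT (d * U x) mass_integrable.
split.
  rewrite (integrable_mkcond _ measurable_trunc_domain) restrict_EFin.
  rewrite (_ : EFin \o _ = (fun y => d%:E * (tw n ((y : K) - x) * U y)%:E -
                            (d * U x)%:E * (tw n ((y : K) - x))%:E)%E).
    exact: integrableB.
  by apply/funext => y /=; rewrite trunc_difference_patch.
rewrite Rintegral_mkcond.
transitivity (\int[mu]_y (d * (tw n ((y : K) - x) * U y) -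
    (d * U x) * tw n ((y : K) - x))).
  by apply: eq_Rintegral => y _; exact: trunc_difference_patch.
rewrite RintegralB// !RintegralZl//.
rewrite (trunc_riesz_integral hv hball alpha0 alpha1 mf vs hfin).
rewrite (kernelR_change hv hball alpha0 alpha1 mf vs hfin).2.
have -> : \int[mu]_y tw n ((y : K) - x) = trunc_mass q alpha n.
  by rewrite /Rintegral (integral_trunc_weight hv hball alpha0).
ring.
Qed.

End RealDifference.

(** * Complex-valued densities *)

Section ComplexParts.
Context {R : realType}.
Implicit Types (r : R) (z w : R[i]).
Local Notation normc := ComplexField.Normc.normc.

Lemma Re_realM r z : complex.Re (r%:C%C * z) = r * complex.Re z.
Proof. by case: z => a b /=; rewrite mul0r subr0. Qed.

Lemma Im_realM r z : complex.Im (r%:C%C * z) = r * complex.Im z.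
Proof. by case: z => a b /=; rewrite mul0r addr0. Qed.

Lemma ReB z w : complex.Re (z - w) = complex.Re z - complex.Re w.
Proof. by case: z; case: w. Qed.

Lemma ImB z w : complex.Im (z - w) = complex.Im z - complex.Im w.
Proof. by case: z; case: w. Qed.

Lemma Re_divr r z : complex.Re (z / r%:C%C) = complex.Re z / r.
Proof. by rewrite mulrC -fmorphV Re_realM mulrC. Qed.

Lemma Im_divr r z : complex.Im (z / r%:C%C) = complex.Im z / r.
Proof. by rewrite mulrC -fmorphV Im_realM mulrC. Qed.

Lemma Re_Cintegral d (T : measurableType d) (mu : {measure set T -> \bar R})
    (D : set T) (f : T -> R[i]) :
  complex.Re (Cintegral mu D f) = \int[mu]_(x in D) complex.Re (f x).
Proof. by []. Qed.

Lemma Im_Cintegral d (T : measurableType d) (mu : {measure set T -> \bar R})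
    (D : set T) (f : T -> R[i]) :
  complex.Im (Cintegral mu D f) = \int[mu]_(x in D) complex.Im (f x).
Proof. by []. Qed.

Lemma normc_Re_le z : `|complex.Re z| <= normc z.
Proof. by case: z => a b /=; rewrite -sqrtr_sqr ler_wsqrtr// lerDl sqr_ge0. Qed.

Lemma normc_Im_le z : `|complex.Im z| <= normc z.
Proof. by case: z => a b /=; rewrite -sqrtr_sqr ler_wsqrtr// lerDr sqr_ge0. Qed.

Lemma normc_nonneg z : 0 <= normc z.
Proof. by case: z => a b /=; exact: sqrtr_ge0. Qed.

Lemma measurable_normc d (T : measurableType d) (f : T -> R[i]) :
  measurable_fun setT (fun x => complex.Re (f x)) ->
  measurable_fun setT (fun x => complex.Im (f x)) ->
  measurable_fun setT (fun x => normc (f x)).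
Proof.
move=> mRe mIm.
rewrite (_ : (fun _ => _) =
  (fun x => (complex.Re (f x) ^+ 2 + complex.Im (f x) ^+ 2) `^ (2^-1))).
  apply: (measurableT_comp (measurable_powR _)).
  by apply: measurable_funD; exact: measurable_funX.
apply/funext => x; rewrite powR12_sqrt ?addr_ge0 ?sqr_ge0//.
by case: (f x).
Qed.

Lemma CLp_powR_integral d (T : measurableType d) (mu : {measure set T -> \bar R})
    (p : R) (f : T -> R[i]) : 1 <= p -> CLp mu p f ->
  (\int[mu]_x (normc (f x) `^ p)%:E < +oo)%E.
Proof.
move=> p1 [_ _ Lp].
have p0 : p != 0 by rewrite gt_eqF// (lt_le_trans ltr01).
rewrite (_ : (\int[mu]_x (normc (f x) `^ p)%:E =
  (Lnorm mu p%:E (fun x => (normc (f x))%:E)) `^ p)%E); first exact: poweR_lty.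
rewrite (poweR_Lnorm _ _ p0); apply: eq_integral => x _.
by rewrite /= ger0_norm// normc_nonneg.
Qed.

End ComplexParts.

Section ComplexRepresentation.
Context {R : realType} {K : topologicalFieldType} {q : nat} {v : K -> R}.
Hypothesis hv : normalized_abs v q.
Local Notation B := (borel K).
Context {mu : {sigma_finite_measure set (borel K) -> \bar R}}.
Hypothesis hball : ball_measure v q mu.
Local Notation Q := (q%:R : R).
Context {alpha : R}.
Hypotheses (alpha0 : 0 < alpha) (alpha1 : alpha < 1).
Context {phi : K -> R[i]}.
Local Notation normc := ComplexField.Normc.normc.
Hypothesis mRe : measurable_fun setT (fun z : B => complex.Re (phi z)).
Hypothesis mIm : measurable_fun setT (fun z : B => complex.Im (phi z)).
Local Notation u := (riesz mu v q alpha phi).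
Local Notation d := (riesz_coef q alpha).

Lemma Re_riesz y :
  complex.Re (u y) = d * @real_riesz R K v mu alpha (fun z => complex.Re (phi z)) y.
Proof.
rewrite /riesz Re_realM Re_Cintegral; congr (_ * _).
by apply: eq_Rintegral => z _; rewrite Re_realM.
Qed.

Lemma Im_riesz y :
  complex.Im (u y) = d * @real_riesz R K v mu alpha (fun z => complex.Im (phi z)) y.
Proof.
rewrite /riesz Im_realM Im_Cintegral; congr (_ * _).
by apply: eq_Rintegral => z _; rewrite Im_realM.
Qed.

Lemma Re_trunc_integrand x y : complex.Re (trunc_integrand v alpha u x y) =
  (d * @real_riesz R K v mu alpha (fun z => complex.Re (phi z)) y -
   d * @real_riesz R K v mu alpha (fun z => complex.Re (phi z)) x) /
  v (y - x) `^ (alpha + 1).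
Proof. by rewrite /trunc_integrand Re_divr ReB; congr ((_ - _) / _); exact: Re_riesz. Qed.

Lemma Im_trunc_integrand x y : complex.Im (trunc_integrand v alpha u x y) =
  (d * @real_riesz R K v mu alpha (fun z => complex.Im (phi z)) y -
   d * @real_riesz R K v mu alpha (fun z => complex.Im (phi z)) x) /
  v (y - x) `^ (alpha + 1).
Proof. by rewrite /trunc_integrand Im_divr ImB; congr ((_ - _) / _); exact: Im_riesz. Qed.

Lemma dominated_riesz_lty (x : K) (f : B -> R) :
  measurable_fun setT f -> (forall z, `|f z| <= normc (phi z)) ->
  (\int[mu]_z (v (x - (z : K))%R `^ (alpha - 1) * normc (phi z))%:E < +oo)%E ->
  (\int[mu]_z (v (x - (z : K))%R `^ (alpha - 1) * `|f z|)%:E < +oo)%E.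
Proof.
move=> mf fphi; apply: le_lt_trans; apply: ge0_le_integral => //.
- by move=> z _; rewrite lee_fin mulr_ge0 ?powR_ge0.
- apply/measurable_EFinP; apply: measurable_funM; first exact: (measurable_riesz_kernel hv).
  exact: measurableT_comp.
- apply/measurable_EFinP; apply: measurable_funM; first exact: (measurable_riesz_kernel hv).
  exact: measurable_normc.
- by move=> z _; rewrite lee_fin ler_wpM2l ?powR_ge0.
Qed.

(** The real and imaginary parts of [phi] are dominated by its modulus, so the
    real representation applies to both at every such [x]. *)
Lemma representation_at (n : int) (sigma x : K) : v sigma = Q ^ n ->
  (\int[mu]_z (v (x - (z : K))%R `^ (alpha - 1) * normc (phi z))%:E < +oo)%E ->
  [/\ Cintegrable mu (trunc_domain v (Q ^ n) x) (trunc_integrand v alpha u x),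
      Cintegrable mu setT
        (fun tau : K => (kernelR v q alpha tau)%:C%C * phi (x - sigma * tau)) &
      trunc_derivative mu v q alpha (Q ^ n) u x =
      (deriv_coef q alpha * d)%:C%C *
        Cintegral mu setT
          (fun tau : K => (kernelR v q alpha tau)%:C%C * phi (x - sigma * tau))].
Proof.
move=> vs hx.
have fRe := dominated_riesz_lty mRe (fun z => normc_Re_le (phi z)) hx.
have fIm := dominated_riesz_lty mIm (fun z => normc_Im_le (phi z)) hx.
have [dRe eRe] := trunc_difference hv hball alpha0 alpha1 mRe vs fRe d.
have [dIm eIm] := trunc_difference hv hball alpha0 alpha1 mIm vs fIm d.
have [kRe _] := kernelR_change hv hball alpha0 alpha1 mRe vs fRe.
have [kIm _] := kernelR_change hv hball alpha0 alpha1 mIm vs fIm.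
have mD := measurable_trunc_domain hv (n := n) (x := x).
split.
- split.
    by apply: eq_integrable dRe => // y _; rewrite Re_trunc_integrand.
  by apply: eq_integrable dIm => // y _; rewrite Im_trunc_integrand.
- split.
    by apply: eq_integrable kRe => // y _; rewrite Re_realM.
  by apply: eq_integrable kIm => // y _; rewrite Im_realM.
rewrite (rmorphM (real_complex R) (deriv_coef q alpha)) -mulrA.
rewrite /trunc_derivative; congr (_ * _); apply/eqP.
rewrite eq_complex Re_realM Im_realM !Re_Cintegral !Im_Cintegral.
apply/andP; split; apply/eqP.
- transitivity (\int[mu]_(y in trunc_domain v (Q ^ n) x)
    ((d * @real_riesz R K v mu alpha (fun z => complex.Re (phi z)) y -
      d * @real_riesz R K v mu alpha (fun z => complex.Re (phi z)) x) /
     v ((y : K) - x) `^ (alpha + 1))).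
    by apply: eq_Rintegral => y _; rewrite Re_trunc_integrand.
  rewrite eRe; congr (_ * _).
  by apply: eq_Rintegral => tau _; rewrite Re_realM.
- transitivity (\int[mu]_(y in trunc_domain v (Q ^ n) x)
    ((d * @real_riesz R K v mu alpha (fun z => complex.Im (phi z)) y -
      d * @real_riesz R K v mu alpha (fun z => complex.Im (phi z)) x) /
     v ((y : K) - x) `^ (alpha + 1))).
    by apply: eq_Rintegral => y _; rewrite Im_trunc_integrand.
  rewrite eIm; congr (_ * _).
  by apply: eq_Rintegral => tau _; rewrite Im_realM.
Qed.

Lemma representation_ae (p : R) (n : int) (sigma : K) :
  1 <= p -> p < alpha^-1 -> (\int[mu]_z (normc (phi z) `^ p)%:E < +oo)%E ->
  v sigma = Q ^ n ->
  {ae mu, forall x : K,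
    [/\ Cintegrable mu (trunc_domain v (Q ^ n) x) (trunc_integrand v alpha u x),
        Cintegrable mu setT
          (fun tau : K => (kernelR v q alpha tau)%:C%C * phi (x - sigma * tau)) &
        trunc_derivative mu v q alpha (Q ^ n) u x =
        (deriv_coef q alpha * d)%:C%C *
          Cintegral mu setT
            (fun tau : K => (kernelR v q alpha tau)%:C%C * phi (x - sigma * tau))]}.
Proof.
move=> p1 p2 hphi vs.
have := riesz_integrable_ae hv hball alpha0 alpha1 p1 p2
  (measurable_normc mRe mIm) (fun z => normc_nonneg (phi z)) hphi.
by apply: filterS => x; exact: representation_at.
Qed.

End ComplexRepresentation.

Section SigmaFiniteMeasure.
Context d (T : measurableType d) (R : realType) (mu : {measure set T -> \bar R}).

(** A copy of the measure that can carry the sigma-finite structure of the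
    hierarchy, which Fubini's theorem requires. *)
Definition sigma_finite_copy (_ : sigma_finite setT mu) : set T -> \bar R := mu.

Hypothesis sf : sigma_finite setT mu.

HB.instance Definition _ := Measure.copy (sigma_finite_copy sf) mu.
HB.instance Definition _ :=
  Measure_isSigmaFinite.Build _ _ _ (sigma_finite_copy sf) sf.

End SigmaFiniteMeasure.

Theorem proposition1 (R : realType) (K : topologicalFieldType)
    (hK : local_field K)
    (q : nat) (v : K -> R) (hv : normalized_abs v q)
    (mu : {measure set (borel K) -> \bar R})
    (hmu : haar_measure mu) (hmuO : mu (integers v) = 1%E)
    (alpha p : R) (halpha0 : 0 < alpha) (halpha1 : alpha < 1)
    (hp1 : 1 <= p) (hp2 : p < alpha^-1)
    (phi : K -> R[i]) (hphi : CLp mu p phi)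
    (u : K -> R[i]) (hu : u = riesz mu v q alpha phi)
    (nu : nat) (eps : R) (heps : eps = q%:R ^- nu)
    (sigma : K) (hsigma : v sigma = eps) :
  {ae mu, forall x : K,
    [/\ Cintegrable mu (trunc_domain v eps x) (trunc_integrand v alpha u x),
        Cintegrable mu setT
          (fun tau : K => (kernelR v q alpha tau)%:C%C * phi (x - sigma * tau)) &
        trunc_derivative mu v q alpha eps u x =
        (deriv_coef q alpha * riesz_coef q alpha)%:C%C *
          Cintegral mu setT
            (fun tau : K => (kernelR v q alpha tau)%:C%C * phi (x - sigma * tau))]} /\
  (forall tau : K, 0 < v tau -> v tau < 1 -> 0 < kernelR1 v q alpha tau) /\
  (\int[mu]_tau (kernelR1 v q alpha tau)%:E = 1)%E.
Proof.
have hball := haar_ball_measure hv hmu hmuO.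
split; last first.
  split; last exact: (integral_kernelR1 hv hball halpha0 halpha1).
  exact: (kernelR1_gt0 hv halpha0 halpha1).
have sf := ball_measure_sigma_finite hv hball.
pose mu' : {sigma_finite_measure set (borel K) -> \bar R} := sigma_finite_copy sf.
subst u eps.
have vs : v sigma = q%:R ^ (- nu%:Z) by rewrite hsigma exprnN.
have [mRe mIm _] := hphi.
have := @representation_ae R K q v hv mu' hball alpha halpha0 halpha1 phi mRe mIm p
  (- nu%:Z) sigma hp1 hp2 (CLp_powR_integral hp1 hphi) vs.
by rewrite -exprnN.
Qed.
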